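(* Let $h$ be a positive integer and let $\Delta_h\subset\mathbb R^3$ be the Reeve tetrahedron $\Delta_h=\operatorname{conv}\{(0,0,0),(0,1,0),(1,0,0),(1,1,h)\}$. The first Grassmann polynomial of the Reeve tetrahedron has the following form: $$G_{1,\Delta_h}(t)=\frac h6t^3+t^2+\left(S-\frac h6\right)t,$$ where $S=S(\Delta_h)$ is the sum of the solid angles at the vertices of $\Delta_h$.
   Context: Here $d=3$. For a polytope $P\subset\mathbb R^3$ and $v\in P$, the tangent cone is $T_v(P)=\operatorname{pos}(P-v)=\{\lambda(x-v):x\in P,\lambda\ge0\}$. The solid angle of $\Delta_h$ at a vertex $v$ is $\alpha(T_v(\Delta_h))$, where $\alpha(C)$ (for a full-dimensional cone $C\subseteq\mathbb R^3$) is the probability that a random vector uniformly distributed on the unit sphere $\mathbb S^2$ lies in $C$ (so the full angle is normalized to $1$). Let $W_m$ be a random $m$-dimensional linear subspace of $\mathbb R^3$ distributed according to the rotation-invariant (Haar) probability measure on the Grassmannian, let $U$ be uniformly distributed on $\mathbb S^2$ independently of $W_m$, and let $W_m^+=W_m\cap\{x\in\mathbb R^3:\langle x,U\rangle\ge0\}$. For a convex cone $C\subseteq\mathbb R^3$ and $k\in\{0,1,2,3\}$, $\alpha_k(C)=\mathbb P[C\cap W_{3-k}^+\ne\{0\}]$. For a lattice polytope $P\subset\mathbb R^3$ (vertices in $\mathbb Z^3$), $G_k(P)=\sum_{v\in P\cap\mathbb Z^3}\alpha_k(T_v(P))$. For a full-dimensional lattice polytope $P$, the function $n\mapsto G_k(nP)$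 (with $nP=\{nu:u\in P\}$) agrees with a polynomial for positive integers $n$; the $k$-th Grassmann polynomial $G_{k,P}(t)$ is the unique polynomial with $G_{k,P}(n)=G_k(nP)$ for all positive integers $n$. *)

(* Defs.v *)
From HB Require Import structures.
From mathcomp Require Import all_boot all_order all_algebra.
From mathcomp Require Import all_classical all_reals all_analysis.

Set Implicit Arguments.
Unset Strict Implicit.
Unset Printing Implicit Defensive.

Import Order.TTheory GRing.Theory Num.Theory.
Import numFieldNormedType.Exports.

Local Open Scope classical_set_scope.
Local Open Scope ring_scope.

Notation borel T := (g_sigma_algebraType (@open T)).

Section geometry.
Variable R : realType.
Implicit Types (u v x : 'rV[R]_3) (P C A : set 'rV[R]_3) (h n : nat).

Definition dot u v : R := (u *m v^T) ord0 ord0.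

(* The norm carried by 'rV[R]_3 in the library is the sup norm, so the
   Euclidean sphere has to be written with the dot product. *)
Definition unit_sphere : set 'rV[R]_3 := [set u | dot u u = 1].

Definition convex_hull A : set 'rV[R]_3 :=
  smallest (@convex_set R 'rV[R]_3) A.

Definition point3 (a b c : R) : 'rV[R]_3 := \row_(j < 3) [:: a; b; c]`_j.

Definition reeve h : set 'rV[R]_3 :=
  convex_hull [set x | x \in [:: point3 0 0 0; point3 0 1 0;
                                 point3 1 0 0; point3 1 1 h%:R]].

Definition lattice : set 'rV[R]_3 :=
  [set v | forall j, v ord0 j \is a Num.int].

Definition dilate n P : set 'rV[R]_3 := [set n%:R *: u | u in P].

Definition tangent_cone P v : set 'rV[R]_3 :=
  [set y | exists2 x, P x & exists2 l : R, 0 <= l & y = l *: (x - v)].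

(* {v} is a face: some linear functional attains its maximum over P exactly
   at v. *)
Definition vertices P : set 'rV[R]_3 :=
  [set v | P v /\
     exists c, forall x, P x -> x <> v -> dot c x < dot c v].

(* SO(3), acting on row vectors by right multiplication. *)
Definition rotation (Q : 'M[R]_3) : Prop := Q *m Q^T = 1%:M /\ \det Q = 1.

(* A linear subspace of R^3 is represented by the matrix of the orthogonal
   projection onto it, of which it is the row space; the Grassmannian thus gets
   its usual topology, as a compact subset of 'M[R]_3. *)
Definition grassmannian (m : nat) : set 'M[R]_3 :=
  [set W | [/\ W^T = W, W *m W = W & \rank W = m]].

(* If W projects onto L, then Q^T *m W *m Q projects onto the image of L under
   x |-> x *m Q. *)
Definition haar_grassmannian (m : nat)
    (gamma : probability (borel 'M[R]_3) R) : Prop :=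
  gamma (grassmannian m) = 1%E /\
  forall Q, rotation Q -> forall B : set (borel 'M[R]_3), measurable B ->
    gamma ((fun W => Q^T *m W *m Q) @^-1` B) = gamma B.

Definition uniform_sphere (sigma : probability (borel 'rV[R]_3) R) : Prop :=
  sigma unit_sphere = 1%E /\
  forall Q, rotation Q -> forall B : set (borel 'rV[R]_3), measurable B ->
    sigma ((fun u => u *m Q) @^-1` B) = sigma B.

Definition half_subspace (W : 'M[R]_3) u : set 'rV[R]_3 :=
  [set x | (x <= W)%MS /\ 0 <= dot x u].

End geometry.

Arguments unit_sphere R : clear implicits.
Arguments lattice R : clear implicits.
Arguments reeve R h : clear implicits.
Arguments grassmannian R m : clear implicits.

Section grassmann_angles.
Variable R : realType.
(* gamma m is the law of the random m-dimensional subspace W_m and sigma that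
   of the independent direction U; the joint law is the product measure. *)
Variables (gamma : nat -> probability (borel 'M[R]_3) R)
          (sigma : probability (borel 'rV[R]_3) R).
Implicit Types (P C : set 'rV[R]_3) (k : nat) (p : {poly R}).

Definition solid_angle C : R := fine (sigma C).

Definition solid_angle_sum P : R :=
  \sum_(v \in vertices P) solid_angle (tangent_cone P v).

Definition grassmann_angle k C : R :=
  fine ((gamma (3 - k) \x sigma)%E
    [set w | C `&` half_subspace w.1 w.2 <> [set 0]]).

Definition grassmann_sum k P : R :=
  \sum_(v \in P `&` lattice R) grassmann_angle k (tangent_cone P v).

Definition is_grassmann_poly k P p : Prop :=
  forall n, (0 < n)%N -> p.[n%:R] = grassmann_sum k (dilate n P).

(* The polynomial agreeing with n |-> grassmann_sum k (dilate n P) on positive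
   integers, and 0 if there is none. *)
Definition grassmann_poly k P : {poly R} :=
  xget 0 [set p | is_grassmann_poly k P p].

Lemma is_grassmann_poly_inj k P p q :
  is_grassmann_poly k P p -> is_grassmann_poly k P q -> p = q.
Proof.
move=> hp hq; apply/eqP; rewrite -subr_eq0; apply/eqP.
apply: (@roots_geq_poly_eq0 _ _ [seq i.+1%:R | i <- iota 0 (size (p - q))]).
- apply/allP => _ /mapP[i _ ->].
  by rewrite rootE hornerD hornerN hp// hq// subrr.
- rewrite map_inj_uniq ?iota_uniq// => i j /eqP.
  by rewrite eqr_nat => /eqP[].
- by rewrite size_map size_iota.
Qed.

Lemma grassmann_polyE k P p :
  is_grassmann_poly k P p -> grassmann_poly k P = p.
Proof.
move=> hp; apply: xget_subset1 => // q1 q2; exact: is_grassmann_poly_inj.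
Qed.

End grassmann_angles.

(* Main.v *)
(* A random half-plane W^+ meets a cone C whose trace on the plane W is a planar
   cone of angle t < pi with probability 1/2 + t/(2 pi), and averaging t/(2 pi)
   over W gives back the solid angle of C. Hence the first Grassmann angle of C is
   1/2 P[W meets C outside 0] + (solid angle of C) when C is a wedge or a vertex
   cone; it is 1 for half-spaces and for the whole space. Angles are avoided by
   using invariance under a quarter turn about the normal of W, and a Fubini
   argument with a random rotation identifies the invariant measure obtained by
   projecting the sphere to W.

   A generic plane direction meets exactly two of the four vertex cones of a
   tetrahedron, so the angles at the vertices add up to S + 1, and Gram's relation
   makes the angles at the six edges add up to S + 4. The lattice points of the
   n-th dilate are the compositions of n into four parts (integral barycentric
   coordinates, the zero parts giving the face) together with h - 1 times the
   compositions of n - 2 into four parts, all of these in the interior. *)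

Require Import Defs.
From HB Require Import structures.
From mathcomp Require Import all_boot all_order all_algebra.
From mathcomp Require Import all_classical all_reals all_analysis.
From mathcomp Require Import measurable_realfun zify ring lra.

Set Implicit Arguments.
Unset Strict Implicit.
Unset Printing Implicit Defensive.

Import Order.TTheory GRing.Theory Num.Theory.
Import numFieldNormedType.Exports.

Local Open Scope classical_set_scope.
Local Open Scope ring_scope.

(** * Vectors and rotations in dimension three *)

(** The laws [gamma] and [sigma] are given only through rotation invariance and full mass on the
    Grassmannian and on the sphere, so everything is extracted from invariance: null sets come from
    counting incidences, the value 1/2 from a rotation reversing a vector, and uniqueness of the
    invariant law in the weak form of agreement on polyhedral cones. The planar formulas are
    established only for planes containing no edge direction, hence the constant work with sets of
    full measure. The event in the Grassmann angle is never shown to be measurable: its product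
    measure is by definition an integral over sections, evaluated on those planes alone.

    Only sums of angles over faces of equal dimension matter, because every edge of the [n]-th
    dilate has [n - 1] interior lattice points. Each of the four facets has binomial(n - 1, 2) of
    them, so the total is (S + 1) + (n - 1) (S + 4) + 4 binomial(n - 1, 2) + binomial(n - 1, 3) + (h
    - 1) binomial(n + 1, 3), whose constant terms cancel. *)

Section euclidean_space.
Variable R : realType.
Implicit Types (u v w x y a b c : 'rV[R]_3) (Q W : 'M[R]_3).

Lemma big_ord3 (F : 'I_3 -> R) : \sum_i F i = F 0 + F 1 + F 2.
Proof.
rewrite !big_ord_recl big_ord0 addr0 addrA.
by congr (_ + F _ + F _); apply/val_inj.
Qed.

Lemma ord3P (P : 'I_3 -> Prop) : P 0 -> P 1 -> P 2 -> forall i, P i.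
Proof.
move=> P0 P1 P2 [[|[|[|]]]]// lt_i3.
- by rewrite (_ : Ordinal _ = 0)//; exact/val_inj.
- by rewrite (_ : Ordinal _ = 1)//; exact/val_inj.
- by rewrite (_ : Ordinal _ = 2)//; exact/val_inj.
Qed.

Lemma row3P u v :
  u 0 0 = v 0 0 -> u 0 1 = v 0 1 -> u 0 2 = v 0 2 -> u = v.
Proof. by move=> e0 e1 e2; apply/rowP; apply: ord3P. Qed.

Lemma point3E (r s t : R) :
  (point3 r s t 0 0 = r) * (point3 r s t 0 1 = s) * (point3 r s t 0 2 = t).
Proof. by rewrite !mxE. Qed.

Lemma dotE u v : dot u v = u 0 0 * v 0 0 + u 0 1 * v 0 1 + u 0 2 * v 0 2.
Proof. by rewrite /dot mxE big_ord3 !mxE. Qed.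

Definition cross u v : 'rV[R]_3 :=
  point3 (u 0 1 * v 0 2 - u 0 2 * v 0 1) (u 0 2 * v 0 0 - u 0 0 * v 0 2)
         (u 0 0 * v 0 1 - u 0 1 * v 0 0).

Definition vec_simp := (point3E, dotE).

Lemma dotC u v : dot u v = dot v u.
Proof. by rewrite !dotE; ring. Qed.

Lemma dotDl u v w : dot (u + v) w = dot u w + dot v w.
Proof. by rewrite !dotE !mxE; ring. Qed.

Lemma dotZl k u w : dot (k *: u) w = k * dot u w.
Proof. by rewrite !dotE !mxE; ring. Qed.

Lemma dotNl u w : dot (- u) w = - dot u w.
Proof. by rewrite !dotE !mxE; ring. Qed.

Lemma dotBl u v w : dot (u - v) w = dot u w - dot v w.
Proof. by rewrite dotDl dotNl. Qed.

Lemma dotDr u v w : dot w (u + v) = dot w u + dot w v.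
Proof. by rewrite dotC dotDl !(dotC w). Qed.

Lemma dotZr k u w : dot w (k *: u) = k * dot w u.
Proof. by rewrite dotC dotZl (dotC w). Qed.

Lemma dotNr u w : dot w (- u) = - dot w u.
Proof. by rewrite dotC dotNl (dotC w). Qed.

Lemma dotBr u v w : dot w (u - v) = dot w u - dot w v.
Proof. by rewrite dotDr dotNr. Qed.

Lemma dot0l u : dot 0 u = 0.
Proof. by rewrite dotE !mxE; ring. Qed.

Lemma dot0r u : dot u 0 = 0.
Proof. by rewrite dotC dot0l. Qed.

Lemma dot_sqr_ge0 u : 0 <= dot u u.
Proof. by rewrite dotE -!expr2 !addr_ge0// sqr_ge0. Qed.

Lemma dot_sqr_eq0 u : (dot u u == 0) = (u == 0).
Proof.
apply/eqP/eqP => [|->]; last exact: dot0l.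
rewrite dotE => u0.
by apply: row3P; rewrite !mxE; nra.
Qed.

Lemma dot_sqr_gt0 u : u != 0 -> 0 < dot u u.
Proof. by rewrite lt_def dot_sqr_ge0 dot_sqr_eq0 andbT. Qed.

Lemma dot_mulmxr u v Q : dot u (v *m Q) = dot (u *m Q^T) v.
Proof. by rewrite /dot trmx_mul mulmxA. Qed.

Lemma dot_mulmxl u v Q : dot (u *m Q) v = dot u (v *m Q^T).
Proof. by rewrite dot_mulmxr trmxK. Qed.

Lemma dot_inj u v : (forall w, dot u w = dot v w) -> u = v.
Proof.
move=> uv; apply/eqP; rewrite -subr_eq0 -dot_sqr_eq0 dotBl uv.
by rewrite subrr.
Qed.

Lemma crossNC u v : cross u v = - cross v u.
Proof. by apply: row3P; rewrite !mxE /=; ring. Qed.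

Lemma crossZr k u v : cross u (k *: v) = k *: cross u v.
Proof. by apply: row3P; rewrite !mxE /=; ring. Qed.

Lemma cross_cross_dot a b c d :
  dot (cross a b) (cross c d) = dot a c * dot b d - dot a d * dot b c.
Proof. by rewrite !vec_simp; ring. Qed.

Lemma cross_dotl a b : dot (cross a b) a = 0.
Proof. by rewrite !vec_simp; ring. Qed.

Lemma cross_dotr a b : dot (cross a b) b = 0.
Proof. by rewrite !vec_simp; ring. Qed.

Lemma cross_dotA a b c : dot (cross a b) c = dot a (cross b c).
Proof. by rewrite !vec_simp; ring. Qed.

Lemma cramer3 a b c u :
  dot (cross a b) c *: u = dot (cross u b) c *: a + dot (cross a u) c *: b
                           + dot (cross a b) u *: c.
Proof. by apply: row3P; rewrite !mxE !vec_simp; ring. Qed.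

Lemma dot_basis0 a b c u : dot (cross a b) c != 0 ->
  dot u a = 0 -> dot u b = 0 -> dot u c = 0 -> u = 0.
Proof.
move=> D0 ua ub uc; apply/eqP; rewrite -dot_sqr_eq0 -(mulrI_eq0 _ (mulfI D0)).
by rewrite -dotZl cramer3 !dotDl !dotZl !(dotC _ u) ua ub uc !mulr0 !addr0.
Qed.

Definition frame a b c : 'M[R]_3 := \matrix_(i < 3) [:: a; b; c]`_i.

Lemma mulmx_frame u a b c :
  u *m frame a b c = u 0 0 *: a + u 0 1 *: b + u 0 2 *: c.
Proof. by apply/rowP => j; rewrite !mxE big_ord3 !mxE. Qed.

Lemma mulmx_frameT u a b c :
  u *m (frame a b c)^T = point3 (dot u a) (dot u b) (dot u c).
Proof. by apply: row3P; rewrite !mxE /= dotE big_ord3 !mxE. Qed.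


Lemma det3E Q : \det Q = dot (cross (row 0 Q) (row 1 Q)) (row 2 Q).
Proof.
rewrite (expand_det_row _ 0) big_ord3 /cofactor.
have det2 (A : 'M[R]_2) : \det A = A 0 0 * A 1 1 - A 0 1 * A 1 0.
  rewrite (expand_det_row _ 0) !big_ord_recl big_ord0 /cofactor !det_mx11 !mxE.
  rewrite (_ : lift 0 _ = 1); last exact/val_inj.
  by rewrite (_ : lift 1 _ = 0); [rewrite /=; ring|exact/val_inj].
rewrite !det2 !vec_simp !mxE /=.
have l (i : 'I_3) (j : 'I_2) (k : 'I_3) : bump i j == k :> nat -> lift i j = k.
  by move=> /eqP ijk; exact/val_inj.
rewrite !(l 0 0 1)// !(l 0 1 2)// !(l 1 0 0)// !(l 1 1 2)// !(l 2 0 0)//.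
rewrite !(l 2 1 1)//= /bump /=; ring.
Qed.

Lemma rotation_frame a b :
  dot a a = 1 -> dot b b = 1 -> dot a b = 0 -> rotation (frame a b (cross a b)).
Proof.
move=> aa bb ab; split; last first.
  rewrite det3E !rowK /= cross_cross_dot aa bb ab dotC ab; ring.
apply/row_matrixP => i; rewrite row_mul mulmx_frameT.
elim/ord3P: i; rewrite rowK /=; apply: row3P; rewrite !mxE /=;
  rewrite ?aa ?bb ?ab ?[dot b a]dotC ?ab ?cross_cross_dot ?aa ?bb ?ab //;
  rewrite ?[dot _ (cross _ _)]dotC ?cross_dotl ?cross_dotr // ?[dot b a]dotC;
  by rewrite ?ab ?mulr1 ?mul0r ?subr0.
Qed.

Lemma rotation_trmx Q : rotation Q -> rotation Q^T.
Proof.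
move=> [QQ dQ]; split; last by rewrite det_tr.
by rewrite trmxK; exact: mulmx1C.
Qed.

Lemma rotation_mul Q1 Q2 : rotation Q1 -> rotation Q2 -> rotation (Q1 *m Q2).
Proof.
move=> [QQ1 dQ1] [QQ2 dQ2]; split; last by rewrite det_mulmx dQ1 dQ2 mulr1.
by rewrite trmx_mul mulmxA -(mulmxA Q1) QQ2 mulmx1.
Qed.

Lemma rotationK Q u : rotation Q -> u *m Q *m Q^T = u.
Proof. by move=> [QQ _]; rewrite -mulmxA QQ mulmx1. Qed.

Lemma rotationKV Q u : rotation Q -> u *m Q^T *m Q = u.
Proof. by move=> [/mulmx1C QQ _]; rewrite -mulmxA QQ mulmx1. Qed.

Lemma dot_rotation Q u v : rotation Q -> dot (u *m Q) (v *m Q) = dot u v.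
Proof. by move=> rQ; rewrite dot_mulmxr rotationK. Qed.

Lemma cross_dot_mulmx Q a b c :
  dot (cross (a *m Q) (b *m Q)) (c *m Q) = \det Q * dot (cross a b) c.
Proof.
have tri (u v w : 'rV[R]_3) : dot (cross u v) w = \det (frame u v w).
  by rewrite det3E !rowK.
rewrite !tri mulrC -det_mulmx; congr (\det _).
by apply/row_matrixP => i; rewrite row_mul !rowK; elim/ord3P: i.
Qed.

(** Tested against [w *m Q], both sides give triple products, which a matrix multiplies by its
    determinant; this is where determinant 1 enters. *)
Lemma cross_rotation Q u v : rotation Q ->
  cross (u *m Q) (v *m Q) = cross u v *m Q.
Proof.
move=> rQ; apply: dot_inj => w; rewrite -(rotationKV w rQ) cross_dot_mulmx.
by rewrite dot_rotation// rQ.2 mul1r.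
Qed.

Lemma normalize_sqr u : u != 0 ->
  dot ((Num.sqrt (dot u u))^-1 *: u) ((Num.sqrt (dot u u))^-1 *: u) = 1.
Proof.
move=> u0; rewrite dotZl dotZr mulrA -invfM -expr2 sqr_sqrtr ?dot_sqr_ge0//.
by rewrite mulVf// dot_sqr_eq0.
Qed.

Lemma exists_orthogonal u : exists2 v, v != 0 & dot u v = 0.
Proof.
have [/eqP u0|u0] := eqVneq (u 0 0 ^+ 2 + u 0 1 ^+ 2) 0.
  exists (point3 1 0 0).
    by apply/eqP => /rowP/(_ 0)/eqP; rewrite !mxE /= oner_eq0.
  rewrite !vec_simp; move: u0; rewrite paddr_eq0 ?sqr_ge0// !sqrf_eq0.
  by move=> /andP[/eqP-> _]; ring.
exists (point3 (- u 0 1) (u 0 0) 0); last by rewrite !vec_simp; ring.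
apply: contra_neq u0 => /rowP v0; have := v0 0; have := v0 1.
by rewrite !mxE /= => -> /eqP; rewrite oppr_eq0 => /eqP ->; ring.
Qed.

Lemma exists_rotation_axis u : u != 0 ->
  exists2 Q, rotation Q & u = Num.sqrt (dot u u) *: (point3 1 0 0 *m Q).
Proof.
move=> u0; have [v v0 uv] := exists_orthogonal u.
exists (frame ((Num.sqrt (dot u u))^-1 *: u) ((Num.sqrt (dot v v))^-1 *: v)
   (cross ((Num.sqrt (dot u u))^-1 *: u) ((Num.sqrt (dot v v))^-1 *: v))).
  by apply: rotation_frame; rewrite ?normalize_sqr// dotZl dotZr uv !mulr0.
rewrite mulmx_frame !point3E scale1r !scale0r !addr0 scalerA mulfV ?scale1r//.
by rewrite gt_eqF// sqrtr_gt0 dot_sqr_gt0.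
Qed.

(** Transitivity on directions. The positive factor avoids normalizing normals, since only signs of
    dot products matter later. *)
Lemma exists_rotation u v : u != 0 -> v != 0 ->
  exists2 Q, rotation Q & exists2 l : R, 0 < l & v = l *: (u *m Q).
Proof.
move=> u0 v0; have [P rP uP] := exists_rotation_axis u0.
have [Q rQ vQ] := exists_rotation_axis v0.
exists (P^T *m Q); first by apply: rotation_mul => //; exact: rotation_trmx.
have pos (w : 'rV[R]_3) : w != 0 -> 0 < Num.sqrt (dot w w).
  by move=> w0; rewrite sqrtr_gt0 dot_sqr_gt0.
exists (Num.sqrt (dot v v) / Num.sqrt (dot u u));
  first by rewrite divr_gt0 ?pos.
have uPT : u *m P^T = Num.sqrt (dot u u) *: point3 1 0 0.
  by rewrite {1}uP -scalemxAl rotationK.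
by rewrite mulmxA uPT -scalemxAl scalerA divfK ?gt_eqF ?pos.
Qed.

(* Rodrigues' formula for the rotation by a right angle about the unit vector [w]. *)
Definition quarter_turn w : 'M[R]_3 :=
  frame (cross w (point3 1 0 0) + w 0 0 *: w)
        (cross w (point3 0 1 0) + w 0 1 *: w)
        (cross w (point3 0 0 1) + w 0 2 *: w).

Lemma mulmx_quarter_turn w u : u *m quarter_turn w = cross w u + dot u w *: w.
Proof. by rewrite mulmx_frame; apply: row3P; rewrite !mxE /= !vec_simp;
  ring. Qed.

Lemma rotation_quarter_turn w : dot w w = 1 -> rotation (quarter_turn w).
Proof.
move=> ww.
have orth x y : dot (x *m quarter_turn w) (y *m quarter_turn w) = dot x y.
  rewrite !mulmx_quarter_turn !dotDl !dotDr !dotZl !dotZr cross_cross_dot ww.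
  rewrite cross_dotl [dot w (cross _ _)]dotC cross_dotl [dot w y]dotC; ring.
split.
  apply/row_matrixP => i; rewrite row_mul [row i (quarter_turn w)]rowE.
  apply: dot_inj => y; rewrite row1 -mulmxA.
  by rewrite mulmxA -[_^T]trmxK -dot_mulmxr trmxK orth.
rewrite det3E !rowK /=; transitivity (dot w w ^+ 2); last by rewrite ww expr1n.
by rewrite !vec_simp !mxE /=; ring.
Qed.

End euclidean_space.

(** * Sets of full measure *)

Section full_measure.
Context d (T : measurableType d) (R : realType).
Implicit Types (mu : probability T R) (A B G : set T).

Lemma probability_setI_full mu A G : measurable A -> measurable G ->
  mu G = 1%E -> mu (A `&` G) = mu A.
Proof.
move=> mA mG G1; have mAG := measurableI _ _ mA mG.
apply/eqP; rewrite eq_le le_measure ?inE//=.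
have GC0 : mu (~` G) = 0%E by rewrite probability_setC// G1 subee.
rewrite {1}(_ : A = (A `&` G) `|` (A `&` ~` G)); last first.
  by rewrite -setIUr setUv setIT.
have mGC := measurableC mG; have mAGC := measurableI _ _ mA mGC.
rewrite (le_trans (measureU2 _ _ _))//.
by rewrite -[leRHS]adde0 leeD2l// -GC0 le_measure ?inE.
Qed.

Lemma probability_eq_full mu A B G : measurable A -> measurable B ->
  measurable G -> mu G = 1%E -> A `&` G = B `&` G -> mu A = mu B.
Proof.
move=> mA mB mG G1 AB.
by rewrite -(probability_setI_full mA mG G1) AB probability_setI_full.
Qed.

Lemma probability_setI1 mu A B : measurable A -> measurable B ->
  mu A = 1%E -> mu B = 1%E -> mu (A `&` B) = 1%E.
Proof. by move=> mA mB A1 B1; rewrite probability_setI_full. Qed.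

Lemma probability_sup1 mu A G : measurable A -> measurable G -> G `<=` A ->
  mu G = 1%E -> mu A = 1%E.
Proof.
move=> mA mG GA G1; apply/eqP; rewrite eq_le probability_le1//=.
by rewrite -G1 le_measure ?inE.
Qed.

Import HBNNSimple.

(* No measurability is asked of [f] and [g]: the Grassmann angle of a cone is
   the integral of a function that is only controlled on a set of full measure. *)
Lemma ge0_integral_eq_full mu (f g : T -> \bar R) G : measurable G ->
  mu G = 1%E -> (forall x, (0 <= f x)%E) -> (forall x, (0 <= g x)%E) ->
  (forall x, G x -> f x = g x) -> (\int[mu]_x f x = \int[mu]_x g x)%E.
Proof.
move=> mG G1.
suff le_int (u v : T -> \bar R) : (forall x, (0 <= u x)%E) ->
    (forall x, (0 <= v x)%E) -> (forall x, G x -> u x = v x) ->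
    (\int[mu]_x u x <= \int[mu]_x v x)%E.
  move=> f0 g0 fg; apply/eqP; rewrite eq_le !le_int// => x Gx.
  by rewrite fg.
move=> u0 v0 uv; rewrite !ge0_integralTE//; apply/ge_ereal_sup => _ [h hu <-].
(* Cut down to [G], a simple function below [u] keeps its integral, the complement of [G] being
   null, and lies below [v] everywhere. *)
pose h' := proj_nnsfun h mG.
apply: le_trans (_ : sintegral mu h' <= _)%E; last first.
  apply: ereal_sup_ubound; exists h' => // x; rewrite /= mindicE.
  have [/[!inE] Gx|_] := boolP (x \in G); last by rewrite mulr0.
  by rewrite mulr1 -uv.
rewrite -!integralT_nnsfun.
rewrite le_eqVlt; apply/orP; left; apply/eqP.
have GC0 : mu (~` G) = 0%E by rewrite probability_setC// G1 subee.
apply: ae_eq_integral => //;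
  [exact/measurable_EFinP/measurable_funP|exact/measurable_EFinP/measurable_funP|].
exists (~` G); split; [exact: measurableC|exact: GC0|].
move=> x /=; apply: contra_not => Gx _; rewrite /= mindicE mem_set//.
by rewrite mulr1.
Qed.

(** Linearity of the integral on sums of indicators. Through it and its equality form, Gram's
    relation, the count of vertex cones met by a plane and the nullity of planes reduce to counting
    how many events hold at one generic point. *)
Lemma sum_probability_le mu G (I J : Type) (r : seq I) (s : seq J)
    (P : pred I) (Q : pred J) (A : I -> set T) (B : J -> set T) :
  measurable G -> mu G = 1%E ->
  (forall i, measurable (A i)) -> (forall j, measurable (B j)) ->
  (forall x, G x ->
    \sum_(i <- r | P i) \1_(A i) x <= \sum_(j <- s | Q j) \1_(B j) x :> R) ->
  \sum_(i <- r | P i) fine (mu (A i)) <= \sum_(j <- s | Q j) fine (mu (B j)).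
Proof.
move=> mG G1 mA mB leAB.
have mI (F : set T) : measurable F ->
    measurable_fun G (fun x => (\1_F x)%:E : \bar R).
  by move=> mF; apply/measurable_EFinP; exact: measurable_indic.
have E (K : Type) (u : seq K) (S : pred K) (F : K -> set T) :
    (forall k, measurable (F k)) ->
    (\sum_(k <- u | S k) fine (mu (F k)))%:E =
    (\int[mu]_(x in G) (\sum_(k <- u | S k) (\1_(F k) x))%:E)%E.
  move=> mF; under [RHS]eq_integral do rewrite -sumEFin.
  rewrite -sumEFin -(big_filter u S) [RHS](_ : _ =
    \int[mu]_(x in G) (\sum_(k <- [seq k <- u | S k]) (\1_(F k) x)%:E))%E; last first.
    by apply: eq_integral => x _; rewrite big_filter.
  rewrite ge0_integral_sum//; last by move=> k; exact: mI.
  apply: eq_bigr => k _; rewrite fineK ?fin_num_measure//.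
  by rewrite -(probability_setI_full (mF k) mG G1) integral_indic.
rewrite -lee_fin !E//; apply: ge0_le_integral => //.
- by move=> x _; rewrite lee_fin sumr_ge0.
- apply/measurable_EFinP; rewrite [X in measurable_fun _ X](_ : _ =
    (fun x => \sum_(i <- [seq k <- r | P k]) \1_(A i) x)); last first.
    by apply/funext => x; rewrite big_filter.
  by apply: measurable_sum => i; exact: measurable_indic.
- apply/measurable_EFinP; rewrite [X in measurable_fun _ X](_ : _ =
    (fun x => \sum_(i <- [seq k <- s | Q k]) \1_(B i) x)); last first.
    by apply/funext => x; rewrite big_filter.
  by apply: measurable_sum => i; exact: measurable_indic.
Qed.

Lemma sum_probability_eq mu G (I J : Type) (r : seq I) (s : seq J)
    (P : pred I) (Q : pred J) (A : I -> set T) (B : J -> set T) :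
  measurable G -> mu G = 1%E ->
  (forall i, measurable (A i)) -> (forall j, measurable (B j)) ->
  (forall x, G x ->
    \sum_(i <- r | P i) \1_(A i) x = \sum_(j <- s | Q j) \1_(B j) x :> R) ->
  \sum_(i <- r | P i) fine (mu (A i)) = \sum_(j <- s | Q j) fine (mu (B j)).
Proof.
move=> mG G1 mA mB AB; apply: le_anti; rewrite !(@sum_probability_le _ G)//;
  by move=> x Gx; rewrite AB.
Qed.

End full_measure.

(** * Borel measurability *)

Section borel_sets.

Lemma continuous_borel_measurable (T U : ptopologicalType) (f : T -> U) :
  continuous f -> measurable_fun setT (f : borel T -> borel U).
Proof.
move=> /continuousP cf; apply:
  (@measurability _ _ (borel T) (borel U) setT f (@open U)) => //.
move=> _ [B oB <-]; rewrite setTI; apply: sub_sigma_algebra; exact: cf.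
Qed.

Lemma mx_continuous (K : realType) (T : topologicalType) m n
  (f : T -> 'M[K]_(m, n)) :
  (forall i j, continuous (fun x => f x i j)) -> continuous f.
Proof.
move=> cf x A [P Pnbhs PA].
have: \forall y \near x, forall i j, P i j (f y i j).
  by apply: filter_forall => i; apply: filter_forall => j; apply: cf;
    exact: Pnbhs.
by apply: filterS => y Py; exact: PA.
Qed.

Lemma borel_coord_measurable (K : realType) m n (i : 'I_m) (j : 'I_n) :
  measurable_fun setT (fun M : borel 'M[K]_(m, n) => M i j).
Proof.
apply: (@measurability _ _ (borel 'M[K]_(m, n)) _ _ _ _ (RGenOpens.measurableE K)).
move=> _ [_ [a [b ->] <-]]; rewrite setTI; apply: sub_sigma_algebra.
have /continuousP := @coord_continuous K m n i j; apply.
exact: interval_open.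
Qed.

Lemma continuous_mulmxr (K : realType) m n p (B : 'M[K]_(n, p)) :
  continuous (fun A : 'M[K]_(m, n) => A *m B).
Proof.
apply: mx_continuous => i j; under eq_fun do rewrite mxE.
apply: continuous_big => [|k _]; first exact: add_continuous.
move=> A; apply: (@continuousM _ _ (fun A : 'M[K]_(m, n) => A i k) (fun=> B k j)).
  exact: coord_continuous.
exact: cst_continuous.
Qed.

Lemma continuous_mulmxl (K : realType) m n p (B : 'M[K]_(m, n)) :
  continuous (fun A : 'M[K]_(n, p) => B *m A).
Proof.
apply: mx_continuous => i j; under eq_fun do rewrite mxE.
apply: continuous_big => [|k _]; first exact: add_continuous.
move=> A; apply: (@continuousM _ _ (fun=> B i k) (fun A : 'M[K]_(n, p) => A k j)).
  exact: cst_continuous.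
exact: coord_continuous.
Qed.

End borel_sets.

(** * Measurability of vector-valued functions *)

Section measurable_rows.
Context d (T : measurableType d) (R : realType).
Implicit Types (X Y Z : T -> 'rV[R]_3) (f g : T -> R).

Definition measurable_row Y := forall j, measurable_fun setT (fun t => Y t 0 j).

Lemma measurable_row_cst (v : 'rV[R]_3) : measurable_row (fun=> v).
Proof. by move=> j; exact: measurable_cst. Qed.

Lemma measurable_row3 f g (h : T -> R) : measurable_fun setT f ->
  measurable_fun setT g -> measurable_fun setT h ->
  measurable_row (fun t => point3 (f t) (g t) (h t)).
Proof.
move=> mf mg mh; elim/ord3P; under eq_fun do rewrite point3E; assumption.
Qed.

Lemma measurable_dot X Y : measurable_row X -> measurable_row Y ->
  measurable_fun setT (fun t => dot (X t) (Y t)).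
Proof.
move=> mX mY; under eq_fun do rewrite dotE.
by do !apply: measurable_funD; apply: measurable_funM.
Qed.

Lemma measurable_cross X Y : measurable_row X -> measurable_row Y ->
  measurable_row (fun t => cross (X t) (Y t)).
Proof.
move=> mX mY; apply: measurable_row3;
  by apply: measurable_funB; apply: measurable_funM.
Qed.

Lemma measurable_rowZ f Y : measurable_fun setT f -> measurable_row Y ->
  measurable_row (fun t => f t *: Y t).
Proof.
by move=> mf mY j; under eq_fun do rewrite mxE; exact: measurable_funM.
Qed.

Lemma measurable_row_mulmx Y (F : T -> 'M[R]_3) : measurable_row Y ->
  (forall i j, measurable_fun setT (fun t => F t i j)) ->
  measurable_row (fun t => Y t *m F t).
Proof.
move=> mY mF j; under eq_fun do rewrite mxE big_ord3.
by do !apply: measurable_funD; apply: measurable_funM.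
Qed.

Lemma measurable_ge0 f : measurable_fun setT f -> measurable [set t | 0 <= f t].
Proof.
move=> mf; have := mf measurableT `[0, +oo[%classic (measurable_itv _).
by rewrite setTI; congr measurable; apply/seteqP; split=> t /=;
  rewrite in_itv/= andbT.
Qed.

Lemma measurable_gt0 f : measurable_fun setT f -> measurable [set t | 0 < f t].
Proof.
move=> mf; have := mf measurableT `]0, +oo[%classic (measurable_itv _).
by rewrite setTI; congr measurable; apply/seteqP; split=> t /=;
  rewrite in_itv/= andbT.
Qed.

Lemma measurable_eq0 f : measurable_fun setT f -> measurable [set t | f t = 0].
Proof.
move=> mf; have := mf measurableT [set 0] (measurable_set1 _).
by rewrite setTI.
Qed.

Lemma measurable_row_neq0 Y : measurable_row Y -> measurable [set t | Y t != 0].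
Proof.
move=> mY; rewrite (_ : mkset _ = ~` [set t | dot (Y t) (Y t) = 0]).
  by apply: measurableC; apply: measurable_eq0; exact: measurable_dot.
by apply/seteqP; split => t /=; rewrite -dot_sqr_eq0 => /eqP.
Qed.

End measurable_rows.

Section cones.
Variable R : realType.
Implicit Types (x y : 'rV[R]_3) (A : seq 'rV[R]_3).

Definition cone A : set 'rV[R]_3 :=
  [set x | forall N : 'rV[R]_3, N \in A -> 0 <= dot N x].

Lemma measurable_cone d (T : measurableType d) (I : eqType) (A : seq I)
    (X : I -> T -> R) : (forall i, i \in A -> measurable_fun setT (X i)) ->
  measurable [set t | forall i, i \in A -> 0 <= X i t].
Proof.
elim: A => [|i A IH] mX.
  by rewrite (_ : mkset _ = setT)//; apply/seteqP; split.
rewrite (_ : mkset _ = [set t | 0 <= X i t] `&`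
                       [set t | forall j, j \in A -> 0 <= X j t]).
  apply: measurableI.
    by apply: measurable_ge0; apply: mX; rewrite mem_head.
  by apply: IH => j jA; apply: mX; rewrite in_cons jA orbT.
apply/seteqP; split => t /=.
  move=> Xt; split; first by apply: Xt; rewrite mem_head.
  by move=> j jA; apply: Xt; rewrite in_cons jA orbT.
by move=> [Xi XA] j; rewrite in_cons => /predU1P[->|/XA].
Qed.

Lemma measurable_cone_row d (T : measurableType d) (Y : T -> 'rV[R]_3) A :
  measurable_row Y -> measurable [set t | cone A (Y t)].
Proof.
move=> mY; apply: (@measurable_cone _ _ _ A (fun N t => dot N (Y t))).
by move=> N _; apply: measurable_dot => //; exact: measurable_row_cst.
Qed.

End cones.

(** * Null sets from incidence counts *)

Section null_sets.
Context d (T : measurableType d) (R : realType) (mu : probability T R).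

(* The vectors (1, t, t^2) are in general position: a nonzero vector is orthogonal
   to at most two of them. *)
Lemma incidence_null (Z : 'rV[R]_3 -> set T) (G : set T) :
  measurable G -> mu G = 1%E -> (forall N, measurable (Z N)) ->
  (forall N N' : 'rV[R]_3, N != 0 -> N' != 0 -> mu (Z N) = mu (Z N')) ->
  (forall t, G t -> exists2 y : 'rV[R]_3, y != 0 &
     forall N, Z N t -> dot N y = 0) ->
  forall N : 'rV[R]_3, N != 0 -> mu (Z N) = 0%E.
Proof.
move=> mG G1 mZ Zconst Zdot N N0.
pose e (k : nat) : 'rV[R]_3 := point3 1 k%:R (k%:R ^+ 2).
have e0 k : e k != 0.
  by apply/eqP => /rowP/(_ 0)/eqP; rewrite !mxE /= oner_eq0.
have Zfin := fin_num_measure mu _ (mZ N).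
(* Equal probabilities with at most two events holding at once: [m] of them add up to at most 2, for
   every [m]. *)
suff le2 m : m%:R * fine (mu (Z N)) <= 2.
  rewrite -(fineK Zfin); congr EFin; apply/eqP; rewrite eq_le.
  rewrite fine_ge0 ?measure_ge0// andbT leNgt; apply/negP => Z0.
  have := le2 (Num.truncn (2 / fine (mu (Z N)))).+1; apply/negP.
  by rewrite -ltNge -ltr_pdivrMr// truncnS_gt.
have -> : m%:R * fine (mu (Z N)) = \sum_(i < m) fine (mu (Z (e i))).
  rewrite (eq_bigr (fun=> fine (mu (Z N)))); last by move=> i _;
    rewrite (Zconst _ N).
  by rewrite sumr_const card_ord mulr_natl.
have -> : 2 = \sum_(i < 2) fine (mu setT) :> R.
  by rewrite probability_setT sumr_const card_ord.
apply: (@sum_probability_le _ _ _ mu G) => // t Gt.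
have [y y0 Zy] := Zdot t Gt.
under [leRHS]eq_bigr do rewrite indicT.
rewrite sumr_const card_ord /=.
(* The value of [p] at [k] is [dot (e k) y], so the events holding at [t] give distinct roots of a
   nonzero polynomial of degree at most 2. *)
pose p : {poly R} := \poly_(i < 3) y 0 (inord i).
have p0 : p != 0.
  apply: contra_neq y0 => p0; apply/rowP => j; rewrite mxE.
  by have := coef_poly 3 (fun i => y 0 (inord i)) j;
    rewrite -/p p0 coef0 ltn_ord inord_val.
have pe k : p.[k%:R] = dot (e k) y.
  rewrite horner_poly; under eq_bigr do rewrite inord_val.
  by rewrite big_ord3 !vec_simp /=; ring.
pose s := [seq (nat_of_ord i)%:R : R | i : 'I_m <- index_enum 'I_m & `[< Z (e i) t >]].
have : (size s < size p)%N.
  apply: max_poly_roots => //.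
    apply/allP => _ /mapP[i + ->]; rewrite mem_filter => /andP[/asboolP Zi _].
    by rewrite /root pe Zy.
  rewrite map_inj_uniq; first exact/filter_uniq/index_enum_uniq.
  by move=> i j /eqP; rewrite eqr_nat => /eqP/val_inj.
rewrite size_map => /leq_trans/(_ (size_poly _ _)); rewrite ltnS => s2.
rewrite (eq_bigr (fun i : 'I_m => (`[< Z (e i) t >] : nat)%:R)); last first.
  by move=> i _; rewrite indicE; congr (_%:R); congr nat_of_bool;
    apply/idP/asboolP; rewrite inE.
rewrite -natr_sum ler_nat (leq_trans _ s2)// size_filter -sum1_count
  [leqRHS]big_mkcond /=.
by apply: leq_sum => i _; case: ifP => // ->.
Qed.

End null_sets.

(** * Invariant measures on the sphere *)

(** By definition the product measure integrates the measures of the sections over the first factor,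
    so an arbitrary [K] is allowed; the event of the Grassmann angle is treated this way. *)
Lemma product_measure_sections d1 d2 (T1 : measurableType d1)
    (T2 : measurableType d2) (R : realType) (P1 : probability T1 R)
    (P2 : probability T2 R) (K : set (T1 * T2)) (g : T1 -> \bar R) (G : set T1) :
  measurable G -> P1 G = 1%E -> (forall x, (0 <= g x)%E) ->
  (forall x, G x -> P2 (xsection K x) = g x) ->
  ((P1 \x P2) K = \int[P1]_x g x)%E.
Proof. by move=> mG G1 g0 Kg; apply: ge0_integral_eq_full mG G1 _ _ _. Qed.

(** Here the order of integration is exchanged: for measurable [K], uniqueness of the product
    measure identifies it with the one integrating over the second factor. *)
Lemma product_measure_ysections d1 d2 (T1 : measurableType d1)
    (T2 : measurableType d2) (R : realType) (P1 : probability T1 R)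
    (P2 : probability T2 R) (K : set (T1 * T2)) (g : T2 -> \bar R) (G : set T2) :
  measurable K -> measurable G -> P2 G = 1%E -> (forall y, (0 <= g y)%E) ->
  (forall y, G y -> P1 (ysection K y) = g y) ->
  ((P1 \x P2) K = \int[P2]_y g y)%E.
Proof.
move=> mK mG G1 g0 Kg; rewrite
  (@product_measure_unique _ _ _ _ _ P1 P2 (P1 \x^ P2)%E)//.
  exact: ge0_integral_eq_full mG G1 _ _ _.
by move=> ? ? ? ?; exact: product_measure2E.
Qed.

(** The image measure agrees with the product measure on rectangles, hence on all measurable
    sets. *)
Lemma product_measure_map d1 d2 (T1 : measurableType d1)
    (T2 : measurableType d2) (R : realType) (P1 : probability T1 R)
    (P2 : probability T2 R) (f1 : T1 -> T1) (f2 : T2 -> T2) (K : set (T1 * T2)) :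
  measurable_fun setT f1 -> measurable_fun setT f2 ->
  (forall B, measurable B -> P1 (f1 @^-1` B) = P1 B) ->
  (forall B, measurable B -> P2 (f2 @^-1` B) = P2 B) -> measurable K ->
  (P1 \x P2)%E [set p | K (f1 p.1, f2 p.2)] = (P1 \x P2)%E K.
Proof.
move=> mf1 mf2 Pf1 Pf2 mK.
pose phi (p : T1 * T2) := (f1 p.1, f2 p.2).
have mphi : measurable_fun setT phi.
  apply: measurable_fun_pair.
    exact: measurableT_comp mf1 measurable_fst.
  exact: measurableT_comp mf2 measurable_snd.
apply/esym; unshelve refine (@product_measure_unique _ _ _ _ R P1 P2
  (pushforward (P1 \x P2)%E phi : {measure set (T1 * T2) -> \bar R}) _ _ mK).
  exact: mphi.
move=> B1 B2 mB1 mB2; rewrite /pushforward/= -[in RHS]Pf1// -[in RHS]Pf2//.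
rewrite -product_measure1E//.
- by rewrite -[X in measurable X]setTI; exact: mf1.
- by rewrite -[X in measurable X]setTI; exact: mf2.
Qed.

Section uniform_sphere_theory.
Variable R : realType.
Variable sigma : probability (borel 'rV[R]_3) R.
Hypothesis hsigma : uniform_sphere sigma.
Implicit Types (u v w x y N : 'rV[R]_3) (Q : 'M[R]_3) (A : seq 'rV[R]_3).

Lemma measurable_row_id : measurable_row (fun u : borel 'rV[R]_3 => u).
Proof. by move=> j; exact: borel_coord_measurable. Qed.

Lemma measurable_dotl N : measurable_fun setT
  (fun u : borel 'rV[R]_3 => dot N u).
Proof. exact: measurable_dot (measurable_row_cst N) measurable_row_id. Qed.

Lemma measurable_unit_sphere : measurable
  (unit_sphere R : set (borel 'rV[R]_3)).
Proof.
rewrite (_ : unit_sphere R = [set u | dot u u - 1 = 0]).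
  apply: measurable_eq0; apply: measurable_funB => //.
  exact: measurable_dot measurable_row_id measurable_row_id.
by apply/seteqP; split => u /=; [move=> ->; rewrite subrr|move=> /subr0_eq].
Qed.

Lemma unit_sphere_neq0 u : unit_sphere R u -> u != 0.
Proof.
by move=> u1; rewrite -dot_sqr_eq0 u1 oner_eq0.
Qed.

Lemma sigma_rotation Q (B : set (borel 'rV[R]_3)) : rotation Q ->
  measurable B ->
  sigma [set u | B (u *m Q)] = sigma B.
Proof. by move=> rQ mB; exact: hsigma.2. Qed.

(** Rotations carry any plane to any other, so all have the same measure, while a unit vector lies
    in few planes of a family in general position. *)
Lemma plane_null N : N != 0 -> sigma [set u | dot N u = 0] = 0%E.
Proof.
have mZ N' : measurable [set u : borel 'rV[R]_3 | dot N' u = 0].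
  by apply: measurable_eq0; exact: measurable_dotl.
move: N; apply: (incidence_null measurable_unit_sphere hsigma.1) => //.
  move=> N N' N0 N'0; have [Q rQ [l l0 ->]] := exists_rotation N0 N'0.
  rewrite -(sigma_rotation (rotation_trmx rQ))//; congr (sigma _).
  apply/seteqP; split => u /=; rewrite dotZl dot_mulmxl.
    by move=> ->; rewrite mulr0.
  by move=> /eqP; rewrite mulf_eq0 gt_eqF//= => /eqP.
by move=> u /unit_sphere_neq0 u0; exists u.
Qed.

(** Some rotation takes [N] to a positive multiple of [- N], so the two open half-spaces have equal
    measure, and the plane between them is null. *)
Lemma open_halfspace_half N : N != 0 -> fine (sigma [set u | 0 < dot N u]) = 2^-1.
Proof.
move=> N0.
have m0 N' : measurable [set u : borel 'rV[R]_3 | 0 < dot N' u].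
  by apply: measurable_gt0; exact: measurable_dotl.
have mZ : measurable [set u : borel 'rV[R]_3 | dot N u = 0].
  by apply: measurable_eq0; exact: measurable_dotl.
have NN0 : - N != 0 by rewrite oppr_eq0.
have [Q rQ [l l0 lN]] := exists_rotation N0 NN0.
have symm : sigma [set u | 0 < dot N u] = sigma [set u | 0 < dot (- N) u].
  rewrite -(sigma_rotation (rotation_trmx rQ))//; congr (sigma _).
  by apply/seteqP; split => u /=; rewrite lN dotZl dot_mulmxl pmulr_rgt0.
have : sigma (~` [set u | dot N u = 0]) = 1%E.
  by rewrite probability_setC// plane_null// sube0.
rewrite (_ : ~` _ = [set u | 0 < dot N u] `|` [set u | 0 < dot (- N) u]);
  last first.
  apply/seteqP; split => [u /= /eqP|u /=]; rewrite dotNl oppr_gt0.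
    by rewrite neq_lt => /orP[]; [right|left].
  by case=> [/gt_eqF|/lt_eqF] /eqP.
rewrite measureU//; last first.
  apply/seteqP; split => u //= [N1]; rewrite dotNl oppr_gt0 => N2.
  by have := lt_trans N1 N2; rewrite ltxx.
move=> sum1; have {sum1} : (sigma [set u | (0 < dot N u)%R] +
    sigma [set u | (0 < dot (- N) u)%R])%E = 1%E := sum1.
rewrite -symm -[sigma _]fineK ?fin_num_measure// -EFinD => -[]; lra.
Qed.

Lemma closed_halfspace_half N : N != 0 ->
  fine (sigma [set u | 0 <= dot N u]) = 2^-1.
Proof.
move=> N0; rewrite -(open_halfspace_half N0); congr fine.
have mZ : measurable [set u : borel 'rV[R]_3 | dot N u = 0].
  by apply: measurable_eq0; exact: measurable_dotl.
apply: (@probability_eq_full _ _ _ sigma _ _ _ _ _ (measurableC mZ)).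
- by apply: measurable_ge0; exact: measurable_dotl.
- by apply: measurable_gt0; exact: measurable_dotl.
- by rewrite probability_setC// plane_null// sube0.
apply/seteqP; split => u /= [Nu N0u]; split=> //; last exact: ltW.
by rewrite lt_def Nu andbT; apply/eqP.
Qed.

Lemma measurable_mulmxr Q :
  measurable_fun setT (fun u : borel 'rV[R]_3 => u *m Q : borel 'rV[R]_3).
Proof.
refine (@continuous_borel_measurable 'rV[R]_3 'rV[R]_3 (fun u => u *m Q) _);
  exact: continuous_mulmxr.
Qed.

Local Notation sigma2 := (sigma \x sigma)%E.
Local Notation V2 := (borel 'rV[R]_3 * borel 'rV[R]_3)%type.

Lemma sigma2_rotation Q (B : set V2) : rotation Q -> measurable B ->
  sigma2 [set p | B (p.1 *m Q, p.2 *m Q)] = sigma2 B.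
Proof.
move=> rQ; apply: (@product_measure_map _ _ _ _ R sigma sigma (fun u => u *m Q)
  (fun u => u *m Q)); try exact: measurable_mulmxr.
- by move=> *; exact: sigma_rotation.
- by move=> *; exact: sigma_rotation.
Qed.

Lemma measurable_row_comp d1 d2 (T1 : measurableType d1)
  (T2 : measurableType d2)
    (Y : T2 -> 'rV[R]_3) (f : T1 -> T2) :
  measurable_row Y -> measurable_fun setT f -> measurable_row (Y \o f).
Proof. by move=> mY mf j; exact: (measurableT_comp (mY j) mf). Qed.

Let measurable_row_fst : measurable_row (fun p : V2 => p.1).
Proof. exact: measurable_row_comp measurable_row_id measurable_fst. Qed.

Let measurable_row_snd : measurable_row (fun p : V2 => p.2).
Proof. exact: measurable_row_comp measurable_row_id measurable_snd. Qed.

Lemma measurable_cross_neq0 : measurable [set p : V2 | cross p.1 p.2 != 0].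
Proof.
by apply: measurable_row_neq0; exact: measurable_cross.
Qed.

(** For fixed [u] and a nonzero [N] orthogonal to it, the vectors parallel to [u] lie in the plane
    orthogonal to [N], which is null. *)
Lemma sigma2_cross_neq0 : sigma2 [set p | cross p.1 p.2 != 0] = 1%E.
Proof.
rewrite (@product_measure_sections _ _ _ _ _ _ _ _ (cst 1%E) _ measurable_unit_sphere hsigma.1)//.
  by rewrite integral_cst// mul1e; exact: probability_setT.
move=> u /unit_sphere_neq0 u0; have [N N0 uN] := exists_orthogonal u.
have mK := measurable_xsection u measurable_cross_neq0.
have mZ : measurable [set v : borel 'rV[R]_3 | dot N v = 0].
  by apply: measurable_eq0; exact: measurable_dotl.
apply: (probability_sup1 mK (measurableC mZ)); last first.
  by rewrite probability_setC// plane_null// sube0.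
move=> v /= Nv; apply/xsectionP => /=; apply/eqP => uv; apply: Nv.
have := cross_cross_dot u N u v; rewrite uv dot0r [dot N u]dotC uN mulr0 subr0
  => /esym/eqP.
by rewrite mulf_eq0 dot_sqr_eq0 (negbTE u0) => /eqP.
Qed.

(* A multiple of the rotation obtained from [p.1], [p.2] by Gram-Schmidt; not
   normalizing keeps its entries continuous. *)
Definition spin (p : 'rV[R]_3 * 'rV[R]_3) : 'M[R]_3 :=
  let c := cross p.1 p.2 in
  frame (Num.sqrt (dot c c) *: p.1) c (cross p.1 c).

Lemma spin_mulmx Q p : rotation Q -> spin (p.1 *m Q, p.2 *m Q) = spin p *m Q.
Proof.
move=> rQ; rewrite /spin/= !cross_rotation// dot_rotation//.
by apply/row_matrixP; elim/ord3P; rewrite row_mul !rowK //= scalemxAl.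
Qed.

Lemma spin_rotation p : unit_sphere R p.1 -> cross p.1 p.2 != 0 ->
  exists2 Q, rotation Q & exists2 l : R, 0 < l & spin p = l *: Q.
Proof.
move=> p1 c0; pose c := cross p.1 p.2; pose l := Num.sqrt (dot c c).
have l0 : 0 < l by rewrite sqrtr_gt0 dot_sqr_gt0.
exists (frame p.1 (l^-1 *: c) (cross p.1 (l^-1 *: c))).
  by apply: rotation_frame; rewrite ?normalize_sqr// dotZr [dot _ c]dotC
    cross_dotl mulr0.
exists l => //; apply/row_matrixP => i; rewrite linearZ /=.
by elim/ord3P: i; rewrite !rowK /= -/c -/l ?crossZr ?scalerA ?mulfV ?gt_eqF
  ?scale1r.
Qed.

Lemma measurable_spin i j : measurable_fun setT (fun p : V2 => spin p i j).
Proof.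
have mc := measurable_cross measurable_row_fst measurable_row_snd.
have row3 (X Y Z : V2 -> 'rV[R]_3) : measurable_row X -> measurable_row Y ->
    measurable_row Z -> measurable_fun setT
      (fun p => frame (X p) (Y p) (Z p) i j).
  move=> mX mY mZ; under eq_fun do rewrite mxE.
  by elim/ord3P: i; [exact: mX|exact: mY|exact: mZ].
apply: row3 => //; last exact: measurable_cross.
apply: measurable_rowZ => //.
apply: (@measurableT_comp _ _ _ _ _ _ (@Num.sqrt R));
  last exact: measurable_dot.
by apply: continuous_measurable_fun; exact: sqrt_continuous.
Qed.

(* Fubini applied to [Y] and an independent random rotation: turning [Y] does not
   change its law, while a random rotation forgets the direction of [Y]. *)
Lemma invariant_cone_measure d (T : measurableType d) (mu : probability T R)
    (Y : T -> 'rV[R]_3) A : measurable_row Y -> mu [set t | Y t != 0] = 1%E ->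
  (forall Q, rotation Q ->
     mu [set t | cone A (Y t *m Q)] = mu [set t | cone A (Y t)]) ->
  mu [set t | cone A (Y t)] =
  sigma2 [set p | cone [seq N *m spin p | N <- A] (point3 1 0 0)].
Proof.
move=> mY Y0 Yrot.
(* The normals are turned at random by [spin] while [Y] varies; the two orders of integration give
   two values for the probability of this event. *)
pose X := [set q : T * V2 | forall N, N \in A -> 0 <= dot (N *m spin q.2) (Y q.1)].
have mX : measurable X.
  apply: (@measurable_cone _ _ _ _ A (fun N (q : T * V2) => dot (N *m spin q.2) (Y q.1))).
  move=> N _; apply: measurable_dot; last exact: measurable_row_comp
    measurable_fst.
  apply: measurable_row_mulmx; first exact: measurable_row_cst.
  by move=> i j; exact: measurableT_comp (measurable_spin i j) measurable_snd.
pose B := [set p : V2 | cone [seq N *m spin p | N <- A] (point3 1 0 0)].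
have BE p : B p <-> forall N, N \in A -> 0 <= dot (N *m spin p) (point3 1 0 0).
  split => [Bp N NA|Bp _ /mapP[N NA ->]]; last exact: Bp.
  by apply: Bp; exact: map_f.
have mB : measurable B.
  rewrite (_ : B = [set p | forall N, N \in A -> 0 <= dot (N *m spin p) (point3 1 0 0)]).
    apply: (@measurable_cone _ _ _ _ A (fun N (p : V2) => dot (N *m spin p) (point3 1 0 0))).
    move=> N _; apply: measurable_dot; last exact: measurable_row_cst.
    apply: measurable_row_mulmx; first exact: measurable_row_cst.
    exact: measurable_spin.
  by apply/seteqP; split => p /BE.
have X1 : (mu \x sigma2)%E X = sigma2 B.
  have mY0 := measurable_row_neq0 mY.
  rewrite (@product_measure_sections _ _ _ _ _ _ _ _ (cst (sigma2 B)) _ mY0 Y0)//.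
    by rewrite integral_cst// -[RHS]mule1; congr (_ * _)%E;
      exact: probability_setT.
  (* [Y t] is a positive multiple of [point3 1 0 0 *m Q]; equivariance of [spin] transfers [Q] to
     the pair [p], where invariance of [sigma2] absorbs it. *)
  move=> t /= Yt0; have [Q rQ YQ] := exists_rotation_axis Yt0.
  rewrite -[RHS](sigma2_rotation (rotation_trmx rQ))//; congr (sigma2 _).
  apply/seteqP; split => p.
    move=> /xsectionP Xp; apply/BE => N NA.
    move: (Xp N NA); rewrite YQ dotZr pmulr_rge0 ?sqrtr_gt0 ?dot_sqr_gt0//.
    by rewrite spin_mulmx ?mulmxA; [rewrite dot_mulmxr|exact: rotation_trmx].
  move=> /BE Bp; apply/xsectionP => N NA /=; move: (Bp N NA).
  rewrite [in X in _ -> X]YQ dotZr pmulr_rge0 ?sqrtr_gt0 ?dot_sqr_gt0//.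
  by rewrite spin_mulmx ?mulmxA; [rewrite dot_mulmxr|exact: rotation_trmx].
rewrite -X1.
pose G := [set p : V2 | unit_sphere R p.1] `&` [set p | cross p.1 p.2 != 0].
have mS : measurable [set p : V2 | unit_sphere R p.1].
  rewrite -[X in measurable X]setTI.
  exact: (measurable_fst measurableT _ measurable_unit_sphere).
have mG : measurable G by apply: measurableI => //;
  exact: measurable_cross_neq0.
have G1 : sigma2 G = 1%E.
  apply: probability_setI1 => //;
    [exact: measurable_cross_neq0| |exact: sigma2_cross_neq0].
  rewrite (_ : mkset _ = unit_sphere R `*` setT).
    apply: eq_trans (product_measure1E sigma sigma measurable_unit_sphere measurableT) _.
    by rewrite [X in (X * _)%E](hsigma.1) mul1e; exact: probability_setT.
  by apply/seteqP; split => -[p1 p2] //= [].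
rewrite (@product_measure_ysections _ _ _ _ _ _ _ _ (cst (mu [set t | cone A (Y t)])) _ mX mG G1)//.
  rewrite integral_cst// -[LHS]mule1; congr (_ * _)%E.
  by apply/esym; exact: probability_setT.
(* For fixed [p], [spin p] is a positive multiple of a rotation, which the hypothesis [Yrot]
   absorbs. *)
move=> p [/= p1 pc]; have [Q rQ [l l0 pQ]] := spin_rotation p1 pc.
rewrite -(Yrot Q^T (rotation_trmx rQ)); congr (mu _).
apply/seteqP; split => t.
  move=> /ysectionP Xp N NA; move: (Xp N NA).
  by rewrite /= pQ -scalemxAr dotZl pmulr_rge0// dot_mulmxl.
move=> Yt; apply/ysectionP => N NA /=; move: (Yt N NA).
by rewrite pQ -scalemxAr dotZl pmulr_rge0// dot_mulmxl.
Qed.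

(** The value found in [invariant_cone_measure] does not involve [Y], and [sigma] itself is an
    instance. This is uniqueness of the invariant law, as far as polyhedral cones can see it. *)
Lemma invariant_cone_sigma d (T : measurableType d) (mu : probability T R)
    (Y : T -> 'rV[R]_3) A : measurable_row Y -> mu [set t | Y t != 0] = 1%E ->
  (forall Q, rotation Q ->
     mu [set t | cone A (Y t *m Q)] = mu [set t | cone A (Y t)]) ->
  mu [set t | cone A (Y t)] = sigma (cone A).
Proof.
move=> mY Y0 Yrot; rewrite invariant_cone_measure//.
rewrite -(@invariant_cone_measure _ _ sigma idfun A measurable_row_id)//.
- apply: probability_sup1 measurable_unit_sphere _ hsigma.1;
  last exact: unit_sphere_neq0.
  exact: measurable_row_neq0 measurable_row_id.
- by move=> Q rQ; apply: sigma_rotation => //;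
  exact: measurable_cone_row measurable_row_id.
Qed.

End uniform_sphere_theory.

(** * Random planes *)

(** In a full-rank factorization [A = C *m B], idempotence forces [B *m C = 1%:M], and the trace is
    unchanged by swapping the factors. The trace is visibly measurable in the entries and replaces
    the rank in the description of the Grassmannian. *)
Lemma mxtrace_idempotent (F : fieldType) n (A : 'M[F]_n) :
  A *m A = A -> \tr A = (\rank A)%:R.
Proof.
have := mulmx_base A; have := row_base_free A; have := col_base_full A.
move: (\rank A) (col_base A) (row_base A) => r C B C_full B_free <- CBCB.
rewrite mxtrace_mulC (_ : B *m C = 1%:M) ?mxtrace1//.
apply: (row_free_inj B_free); apply: (row_full_inj C_full).
by rewrite /= mul1mx -!mulmxA mulmxA.
Qed.

Lemma measurable_mx_eq d (T : measurableType d) (R : realType) m n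
    (f g : T -> 'M[R]_(m, n)) :
  (forall i j, measurable_fun setT (fun t => f t i j)) ->
  (forall i j, measurable_fun setT (fun t => g t i j)) ->
  measurable [set t | f t = g t].
Proof.
move=> mf mg; rewrite [X in measurable X](_ : _ =
    \bigcap_(ij in [set: 'I_m * 'I_n])
      [set t | f t ij.1 ij.2 - g t ij.1 ij.2 = 0]).
  apply: fin_bigcap_measurable; first exact: finite_finset.
  by move=> ij _; apply: measurable_eq0; exact: measurable_funB.
apply/seteqP; split=> [t /= fg ij _ /=|t /= fg]; first by rewrite fg subrr.
by apply/matrixP => i j; apply/subr0_eq/(fg (i, j)).
Qed.

Section planes.
Variable R : realType.
Implicit Types (u w x a b : 'rV[R]_3) (W Q : 'M[R]_3).

Lemma grassmannianE m : grassmannian R m =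
  [set W | [/\ W^T = W, W *m W = W & \tr W = m%:R]].
Proof.
apply/seteqP; split=> W [WT WW rW]; split=> //.
  by rewrite mxtrace_idempotent// rW.
by move: rW; rewrite mxtrace_idempotent// => /eqP; rewrite eqr_nat => /eqP.
Qed.

Lemma measurable_grassmannian m : measurable
  (grassmannian R m : set (borel 'M[R]_3)).
Proof.
have mW i j : measurable_fun setT (fun W : borel 'M[R]_3 => W i j).
  exact: borel_coord_measurable.
rewrite grassmannianE [X in measurable X](_ : _ =
    [set W | W^T = W] `&` [set W | W *m W = W] `&` [set W | \tr W - m%:R = 0]).
  apply: measurableI; [apply: measurableI|].
  - apply: measurable_mx_eq; last exact: mW.
    by move=> i j; under eq_fun do rewrite mxE; exact: mW.
  - apply: measurable_mx_eq; last exact: mW.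
    move=> i j; under eq_fun do rewrite mxE.
    by apply: measurable_sum => k; apply: measurable_funM; exact: mW.
  - apply: measurable_eq0; apply: measurable_funB => //.
    by apply: measurable_sum => k; exact: mW.
apply/seteqP; split=> W /=.
  by move=> [WT WW ->]; rewrite subrr.
by move=> [[WT WW] /subr0_eq trW].
Qed.

(** [V = 1%:M - W] is a symmetric idempotent of rank one. A unit vector [w] of its row space gives
    [V = A *m w], and [w *m V = w] with the symmetry of [V] yields [A = w^T]. *)
Lemma plane_normal W : grassmannian R 2 W ->
  exists2 w, dot w w = 1 & W = 1%:M - w^T *m w.
Proof.
rewrite grassmannianE => -[WT WW trW]; pose V := 1%:M - W.
have VV : V *m V = V.
  by rewrite /V mulmxBl !mulmxBr !mul1mx mulmx1 WW subrr subr0.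
have VT : V^T = V by rewrite /V linearB /= trmx1 WT.
have rV : \rank V = 1%N.
  apply/eqP; rewrite -(eqr_nat R) -mxtrace_idempotent// /V linearB /= trW.
  by rewrite mxtrace1; apply/eqP; ring.
have [v v0 vV] : exists2 v : 'rV[R]_3, v != 0 & (v <= V)%MS.
  have : V != 0 by rewrite -mxrank_eq0 rV.
  by move=> /rowV0Pn[v vV v0]; exists v.
pose w := (Num.sqrt (dot v v))^-1 *: v.
have ww : dot w w = 1 by exact: normalize_sqr.
have wV : (w <= V)%MS by rewrite scalemx_sub.
have w0 : w != 0 by rewrite -dot_sqr_eq0 ww oner_eq0.
have /submxP[A AV] : (V <= w)%MS.
  by rewrite -(mxrank_leqif_sup wV) rV rank_rV w0.
exists w => //; apply/eqP; rewrite eq_sym subr_eq addrC -subr_eq eq_sym;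
  apply/eqP.
have wwT : w *m w^T = 1%:M.
  by apply/matrixP => i j; rewrite !ord1 [RHS]mxE -[LHS]/(dot w w) ww.
have wVw : w *m V = w by have /submxP[B ->] := wV; rewrite -mulmxA VV.
rewrite -/V {1}AV; congr (_ *m _).
by rewrite -[A]mulmx1 -wwT mulmxA -AV -VT -trmx_mul wVw.
Qed.

End planes.

(** * Traces of cones on a half-plane *)

Section plane_sections.
Variable R : realType.
Implicit Types (u w x a b : 'rV[R]_3) (W Q : 'M[R]_3) (A : seq 'rV[R]_3).

Lemma mulmx_normal u w : u *m (1%:M - w^T *m w) = u - dot u w *: w.
Proof.
rewrite mulmxBr mulmx1 mulmxA; congr (_ - _).
by rewrite [u *m _]mx11_scalar mul_scalar_mx.
Qed.

Lemma half_subspace_normal w u x : dot w w = 1 ->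
  half_subspace (1%:M - w^T *m w) u x <-> dot x w = 0 /\ 0 <= dot x u.
Proof.
move=> ww; split=> -[xw xu]; split=> //.
  by have /submxP[y ->] := xw; rewrite mulmx_normal dotBl dotZl ww mulr1 subrr.
by apply/submxP; exists x; rewrite mulmx_normal xw scale0r subr0.
Qed.

Lemma half_planeP w u A : dot w w = 1 ->
  cone A `&` half_subspace (1%:M - w^T *m w) u <> [set 0] <->
  exists x, [/\ x != 0, cone A x, dot x w = 0 & 0 <= dot x u].
Proof.
move=> ww; split; last first.
  move=> [x [x0 Ax xw xu]] A0; move/eqP: x0; apply.
  have : (cone A `&` half_subspace (1%:M - w^T *m w) u) x.
    by split => //; exact/half_subspace_normal.
  by rewrite A0.
apply: contra_notP => /forallNP nox; apply/seteqP; split => x.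
  move=> [Ax /half_subspace_normal-/(_ ww)[xw xu]].
  by apply: contrapT => /eqP x0; apply: (nox x); split.
move=> ->; split; first by move=> N _; rewrite dot0r.
by apply/half_subspace_normal; rewrite ?dot0l.
Qed.

Lemma cone1P a x : cone [:: a] x <-> 0 <= dot a x.
Proof.
split=> [Ax|ax N]; first by apply: Ax; rewrite mem_head.
by rewrite inE => /eqP->.
Qed.

Lemma cone2P a b x : cone [:: a; b] x <-> 0 <= dot a x /\ 0 <= dot b x.
Proof.
split=> [Ax|[ax bx] N]; first by split; apply: Ax; rewrite !inE eqxx ?orbT.
by rewrite !inE => /orP[] /eqP->.
Qed.

Lemma cone3P a b c x :
  cone [:: a; b; c] x <-> [/\ 0 <= dot a x, 0 <= dot b x & 0 <= dot c x].
Proof.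
split=> [Ax|[ax bx cx] N]; first by split; apply: Ax; rewrite !inE eqxx ?orbT.
by rewrite !inE => /or3P[] /eqP->.
Qed.

(** The plane shares a line with the boundary of the half-space, and one of the two directions of
    that line is nonnegative on [u]. *)
Lemma half_plane_halfspace w u a : dot w w = 1 ->
  exists x, [/\ x != 0, cone [:: a] x, dot x w = 0 & 0 <= dot x u].
Proof.
move=> ww; have w0 : w != 0 by rewrite -dot_sqr_eq0 ww oner_eq0.
suff [y [y0 yw ya]] : exists y, [/\ y != 0, dot y w = 0 & dot a y = 0].
  have [yu|/ltW yu] := leP 0 (dot y u).
    by exists y; split=> //; apply/cone1P; rewrite ya.
  exists (- y); rewrite oppr_eq0 !dotNl yw oppr0 oppr_ge0; split=> //.
  by apply/cone1P; rewrite dotNr ya oppr0.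
have [aw|aw] := eqVneq (cross a w) 0; last first.
  by exists (cross a w); rewrite cross_dotr [dot a _]dotC cross_dotl.
have [y y0 wy] := exists_orthogonal w; exists y; split=> //;
  first by rewrite dotC.
have := cross_cross_dot a w y w; by rewrite aw dot0l ww mulr1 wy mulr0 subr0.
Qed.

(** Write [D] for [dot (cross a b) w]. The trace of the wedge on the plane is spanned by
    [D *: cross b w] and [D *: cross w a], each lying in one facet plane; the two inequalities say
    that [u] is negative on both. *)
Lemma half_plane_wedge w u a b : dot w w = 1 -> dot (cross a b) w != 0 ->
  (exists x, [/\ x != 0, cone [:: a; b] x, dot x w = 0 & 0 <= dot x u]) <->
  ~ (dot (cross u b) w * dot (cross a b) w < 0 /\
     dot (cross a u) w * dot (cross a b) w < 0).
Proof.
move=> ww; set D := dot (cross a b) w => D0; have DD : 0 < D * D.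
  by rewrite -expr2 exprn_even_gt0.
split.
  move=> [x [x0 /cone2P[ax bx] xw xu]] [ub au].
  have := congr1 (fun v => dot v x * D) (cramer3 a b w u).
  rewrite /= -/D !(dotDl, dotZl) [dot w x]dotC xw [dot u x]dotC => E.
  (* By Cramer's rule in the basis [a], [b], [w], the nonnegative [D * D * dot u x] is a combination
     of [dot a x] and [dot b x] with negative coefficients. *)
  have ax0 : dot a x = 0 by nra.
  have bx0 : dot b x = 0 by nra.
  by move/eqP: x0; apply; apply: (dot_basis0 D0) => //; rewrite dotC.
move=> /not_andP[] /negP; rewrite -leNgt => uD.
- exists (D *: cross b w); split.
  + rewrite scaler_eq0 negb_or D0 /=; apply: contra_neq D0 => bw.
    by rewrite /D cross_dotA bw dot0r.
  + apply/cone2P; rewrite !dotZr -cross_dotA -/D [dot b _]dotC cross_dotl mulr0.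
    by split=> //; exact: ltW.
  + by rewrite dotZl cross_dotr mulr0.
  + by rewrite dotZl dotC -cross_dotA mulrC.
- exists (D *: cross w a); split.
  + rewrite scaler_eq0 negb_or D0 /=; apply: contra_neq D0 => wa.
    by rewrite /D dotC -cross_dotA wa dot0l.
  + apply/cone2P; rewrite !dotZr [dot a _]dotC cross_dotr mulr0.
    by rewrite [dot b _]dotC cross_dotA [dot w _]dotC -/D; split=> //;
      exact: ltW.
  + by rewrite dotZl cross_dotl mulr0.
  + by rewrite dotZl cross_dotA dotC mulrC.
Qed.

End plane_sections.

(** * Directions whose half-plane meets a wedge *)

Section wedge_measure.
Variable R : realType.
Variable sigma : probability (borel 'rV[R]_3) R.
Hypothesis hsigma : uniform_sphere sigma.
Implicit Types (u w x a b : 'rV[R]_3) (W Q : 'M[R]_3) (A : seq 'rV[R]_3).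

Lemma indic_asbool T (B : set T) t : \1_B t = (`[< B t >])%:R :> R.
Proof. by rewrite indicE. Qed.

Lemma measurable_lt0 d (T : measurableType d) (f : T -> R) :
  measurable_fun setT f -> measurable [set t | f t < 0].
Proof.
move=> mf; rewrite (_ : mkset _ = ~` [set t | 0 <= f t]).
  by apply: measurableC; exact: measurable_ge0.
by apply/seteqP; split => t /=; rewrite ltNge => /negP.
Qed.

(** The half-space of [b], of measure 1/2, is split by the sign of [dot a u]; strict and weak
    inequalities on [dot b u] differ by a null plane. *)
Let quadrant a b : b != 0 ->
  fine (sigma [set u | dot a u < 0 /\ 0 < dot b u]) =
  2^-1 - fine (sigma [set u | 0 <= dot a u /\ 0 <= dot b u]).
Proof.
move=> b0; rewrite -(open_halfspace_half hsigma b0); apply/eqP.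
rewrite eq_sym subr_eq; apply/eqP.
have mb : measurable [set u : borel 'rV[R]_3 | 0 < dot b u].
  by apply: measurable_gt0; exact: measurable_dotl.
have mZ : measurable [set u : borel 'rV[R]_3 | dot b u = 0].
  by apply: measurable_eq0; exact: measurable_dotl.
have mF : measurable [set u : borel 'rV[R]_3 | dot a u < 0 /\ 0 < dot b u].
  by apply: measurableI => //; apply: measurable_lt0; exact: measurable_dotl.
have mC : measurable [set u : borel 'rV[R]_3 | 0 <= dot a u /\ 0 <= dot b u].
  by apply: measurableI; apply: measurable_ge0; exact: measurable_dotl.
have Z1 : sigma (~` [set u | dot b u = 0]) = 1%E.
  by rewrite probability_setC// plane_null// sube0.
pose E (c : bool) := if c then
  [set u : borel 'rV[R]_3 | dot a u < 0 /\ 0 < dot b u]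
  else [set u | 0 <= dot a u /\ 0 <= dot b u].
pose F (c : bool) := if c then [set u : borel 'rV[R]_3 | 0 < dot b u] else set0.
have := @sum_probability_eq _ _ _ sigma _ bool bool (index_enum bool)
  (index_enum bool) xpredT xpredT F E (measurableC mZ) Z1.
rewrite !big_bool /= measure0 addr0; apply.
- by case; rewrite /F.
- by case; rewrite /E.
move=> u /= /eqP bu; rewrite !big_bool /F /E !indic_asbool /= !asbool_and
  !asboolb asboolF// addr0.
rewrite -natrD [0 <= dot b u]le_eqVlt eq_sym (negbTE bu) /=.
by case: (ltP (dot a u) 0); case: (0 < dot b u).
Qed.

(* The half-plane misses the wedge when [u] is on the negative side of the two
   normals turned by right angles in opposite senses; a quarter turn about [w]
   carries this event to a quadrant. *)
Lemma wedge_plane_measure w a b (E := [set u : borel 'rV[R]_3 |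
    cone [:: a; b] `&` half_subspace (1%:M - w^T *m w) u <> [set 0]]) :
  dot w w = 1 -> dot (cross a b) w != 0 -> measurable E /\
  fine (sigma E) =
    2^-1 + fine (sigma [set u | cone [:: a; b] (u *m (1%:M - w^T *m w))]).
Proof.
move=> ww D0; pose J := quarter_turn w; have rJ := rotation_quarter_turn ww.
set D := dot (cross a b) w in D0.
(* Inner normals of the trace within the plane. The vectors [cross w a] and [cross b w], which span
   its sides up to the sign of [D], are [a'] and [- b'] turned by [J]. *)
pose a' := a - dot a w *: w; pose b' := b - dot b w *: w.
have wa : cross w a = a' *m J.
  rewrite /J mulmx_quarter_turn dotBl dotZl ww mulr1 subrr scale0r addr0.
  by apply: row3P; rewrite !mxE /=; ring.
have wb : cross b w = - (b' *m J).
  rewrite /J mulmx_quarter_turn dotBl dotZl ww mulr1 subrr scale0r addr0.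
  by apply: row3P; rewrite !mxE /=; ring.
have a'0 : a' != 0.
  apply: contra_neq D0 => /eqP; rewrite subr_eq0 /D => /eqP ->.
  by rewrite cross_dotA dotZl [dot w (cross _ _)]dotC cross_dotr mulr0.
have b'0 : b' != 0.
  apply: contra_neq D0 => /eqP; rewrite subr_eq0 /D => /eqP ->.
  by rewrite crossZr dotZl cross_dotr mulr0.
pose F0 := [set u | - D * dot b' u < 0 /\ D * dot a' u < 0].
have mF0 : measurable (F0 : set (borel 'rV[R]_3)).
  apply: measurableI; apply: measurable_lt0; apply: measurable_funM => //;
    exact: measurable_dotl.
have F0E u : F0 (u *m J^T) <-> dot (cross u b) w * D < 0 /\ dot (cross a u) w * D < 0.
  rewrite /F0 /= !dot_mulmxr trmxK -wa.
  have -> : dot (b' *m J) u = - dot (cross u b) w.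
    by rewrite -[b' *m J]opprK -wb dotNl [in RHS]cross_dotA dotC.
  have -> : dot (cross w a) u = dot (cross a u) w by rewrite [in LHS]cross_dotA dotC.
  by rewrite mulrNN mulrC [D * _]mulrC.
have -> : E = ~` [set u | F0 (u *m J^T)].
  apply/seteqP; split => u /=.
    by move=> /half_planeP-/(_ ww)/half_plane_wedge-/(_ ww D0);
      apply: contra_not => /F0E.
  move=> F0u; apply/half_planeP => //; apply/half_plane_wedge => //.
  by apply: contra_not F0u => /F0E.
have mF0J : measurable ([set u | F0 (u *m J^T)] : set (borel 'rV[R]_3)).
  by rewrite -[X in measurable X]setTI; exact: measurable_mulmxr.
split; first exact: measurableC.
rewrite probability_setC// fineB ?fin_num_measure//=.
rewrite (sigma_rotation hsigma (rotation_trmx rJ) mF0).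
have -> : [set u | cone [:: a; b] (u *m (1%:M - w^T *m w))] =
          [set u | 0 <= dot a' u /\ 0 <= dot b' u].
  have dot_proj c u : dot c (u - dot u w *: w) = dot (c - dot c w *: w) u.
    by rewrite dotBr dotZr dotBl dotZl [dot u w]dotC mulrC.
  by apply/seteqP; split => u /=; rewrite mulmx_normal cone2P !dot_proj.
suff -> : fine (sigma F0) = 2^-1 - fine
  (sigma [set u | 0 <= dot a' u /\ 0 <= dot b' u]).
  by field.
(* The sign of [D] only decides which of [a'] and [b'] is positive on the quadrant. *)
have [D_gt0|D_lt0] : 0 < D \/ D < 0 by apply/orP; rewrite orbC -neq_lt.
  rewrite -quadrant//; congr (fine (sigma _)); apply/seteqP; split => u /=;
    by rewrite /F0 /= mulNr oppr_lt0 pmulr_rgt0// pmulr_rlt0// => -[].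
rewrite (_ : [set u | 0 <= dot a' u /\ _] = [set u | 0 <= dot b' u /\ 0 <= dot a' u]); last first.
  by apply/seteqP; split => u /= [].
rewrite -quadrant//; congr (fine (sigma _)); apply/seteqP; split => u /=;
  by rewrite /F0 /= mulNr oppr_lt0 nmulr_rgt0// nmulr_rlt0// => -[].
Qed.

End wedge_measure.

(** * Grassmann angles of cones *)

Section cone_angles.
Variable R : realType.
Variables (gamma : nat -> probability (borel 'M[R]_3) R)
          (sigma : probability (borel 'rV[R]_3) R).
Hypothesis hgamma : haar_grassmannian 2 (gamma 2%N).
Hypothesis hsigma : uniform_sphere sigma.
Implicit Types (u w x y a b c N : 'rV[R]_3) (W Q : 'M[R]_3) (A : seq 'rV[R]_3).

(* For the plane [W] of unit normal [w], this is [(dot x w) * (dot y w)]. *)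
Definition normal_form W x y : R := dot (x *m (1%:M - W)) y.

Lemma normal_formE w x y :
  normal_form (1%:M - w^T *m w) x y = dot x w * dot y w.
Proof.
rewrite /normal_form subKr mulmxA [x *m _]mx11_scalar mul_scalar_mx dotZl.
by rewrite [dot w y]dotC.
Qed.

Lemma measurable_entry i j : measurable_fun setT
  (fun W : borel 'M[R]_3 => W i j).
Proof. exact: borel_coord_measurable. Qed.

Lemma measurable_normal_form x y :
  measurable_fun setT (fun W : borel 'M[R]_3 => normal_form W x y).
Proof.
apply: measurable_dot; last exact: measurable_row_cst.
apply: measurable_row_mulmx; first exact: measurable_row_cst.
move=> i j; under eq_fun do rewrite !mxE.
by apply: measurable_funB => //; exact: measurable_entry.
Qed.

Local Notation G := (grassmannian R 2 : set (borel 'M[R]_3)).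

Let mG : measurable G. Proof. exact: measurable_grassmannian. Qed.

Let G1 : gamma 2%N G = 1%E. Proof. exact: hgamma.1. Qed.

Lemma measurable_conjmx Q :
  measurable_fun setT (fun W : borel 'M[R]_3 => Q^T *m W *m Q : borel 'M[R]_3).
Proof.
refine (@continuous_borel_measurable 'M[R]_3 'M[R]_3 (fun W => Q^T *m W *m Q) _).
move=> W; apply: (@continuous_comp _ _ _ (mulmx Q^T) (fun W => W *m Q)).
  exact: continuous_mulmxl.
exact: continuous_mulmxr.
Qed.

Lemma normal_form_conj Q W x y : rotation Q ->
  normal_form (Q *m W *m Q^T) x y = normal_form W (x *m Q) (y *m Q).
Proof.
move=> rQ; rewrite /normal_form !mulmxBr !mulmx1 !dotBl dot_rotation//.
by rewrite [dot _ (y *m Q)]dot_mulmxr !mulmxA.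
Qed.

(** Dual to the nullity of planes on the sphere: the event says that [N] lies in [W], and the normal
    of [W] plays the part of the random vector. *)
Lemma orthogonal_plane_null N : N != 0 ->
  gamma 2%N [set W | normal_form W N N = 0] = 0%E.
Proof.
have mZ N' : measurable [set W : borel 'M[R]_3 | normal_form W N' N' = 0].
  by apply: measurable_eq0; exact: measurable_normal_form.
move: N; apply: (incidence_null mG G1) => //.
  move=> N N' N0 N'0; have [Q rQ [l l0 ->]] := exists_rotation N0 N'0.
  rewrite -(hgamma.2 _ (rotation_trmx rQ))//; congr (gamma _ _).
  apply/seteqP; split => W /=; rewrite trmxK normal_form_conj// /normal_form;
    rewrite -scalemxAl dotZl dotZr.
    by move=> ->; rewrite !mulr0.
  by move=> /eqP; rewrite !mulf_eq0 !(gt_eqF l0) /= => /eqP.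
move=> W GW; have [w ww ->] := plane_normal GW; exists w.
  by rewrite -dot_sqr_eq0 ww oner_eq0.
by move=> N /= /eqP; rewrite normal_formE mulf_eq0 orbb => /eqP.
Qed.

(** Conjugating [W] and rotating [u] by the same rotation rotates the projection [u *m W], which is
    almost surely nonzero; its law therefore agrees with [sigma] on cones. *)
Lemma projection_cone_measure A :
  (gamma 2%N \x sigma)%E [set p | cone A (p.2 *m p.1)] = sigma (cone A).
Proof.
pose V2 := (borel 'M[R]_3 * borel 'rV[R]_3)%type.
have mY : measurable_row (fun p : V2 => p.2 *m p.1).
  apply: measurable_row_mulmx.
    exact: measurable_row_comp (@measurable_row_id _) measurable_snd.
  by move=> i j; exact: measurableT_comp (measurable_entry i j) measurable_fst.
apply: (invariant_cone_sigma hsigma (mu := (gamma 2%N \x sigma)%E) mY).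
  apply: etrans (@product_measure_sections _ _ _ _ _ _ _ _ (cst 1%E) _ mG G1 _ _) _ => //;
    last by rewrite integral_cst// mul1e; exact: probability_setT.
  move=> W GW; have [w ww ->] := plane_normal GW; have [N N0 wN] :=
    exists_orthogonal w.
  have mZ : measurable [set v : borel 'rV[R]_3 | dot N v = 0].
    by apply: measurable_eq0; exact: measurable_dotl.
  have mK := measurable_xsection (1%:M - w^T *m w : borel 'M[R]_3)
    (measurable_row_neq0 mY).
  apply: (probability_sup1 mK (measurableC mZ)); last first.
    by rewrite probability_setC// plane_null// sube0.
  move=> v /= Nv; apply/xsectionP => /=; apply/eqP; rewrite mulmx_normal => v0.
  by apply: Nv; rewrite (subr0_eq v0) dotZr [dot N w]dotC wN mulr0.
move=> Q rQ.
have := @product_measure_map _ _ _ _ _ (gamma 2%N) sigma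
  (fun W => Q^T *m W *m Q) (fun u => u *m Q) _ (measurable_conjmx Q)
  (measurable_mulmxr Q) (hgamma.2 Q rQ) (hsigma.2 Q rQ)
  (measurable_cone_row A mY).
move=> invQ; apply: etrans invQ; rewrite (_ : mkset _ =
    [set p : V2 | cone A (p.2 *m Q *m (Q^T *m p.1 *m Q))])//.
by apply/seteqP; split=> p /=; rewrite !mulmxA rotationK.
Qed.

Lemma grassmann_angle_halfspace a : grassmann_angle gamma sigma 1 (cone [:: a]) = 1.
Proof.
rewrite /grassmann_angle
  (@product_measure_sections _ _ _ _ _ _ _ _ (cst 1%E) _ mG G1)//.
  by rewrite integral_cst// mul1e [X in fine X](probability_setT _).
move=> W GW; have [w ww ->] := plane_normal GW.
rewrite (_ : xsection _ _ = setT); first exact: probability_setT.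
apply/seteqP; split => // u _; apply/xsectionP => /=; apply/half_planeP => //.
exact: half_plane_halfspace.
Qed.

Lemma grassmann_angle_full : grassmann_angle gamma sigma 1 setT = 1.
Proof.
rewrite -(grassmann_angle_halfspace 0); congr grassmann_angle.
by apply/seteqP; split=> // x _; apply/cone1P; rewrite dot0l.
Qed.

Lemma measurable_projection_cone A :
  measurable [set p : borel 'M[R]_3 * borel 'rV[R]_3 | cone A (p.2 *m p.1)].
Proof.
apply: measurable_cone_row; apply: measurable_row_mulmx.
  exact: measurable_row_comp (@measurable_row_id _) measurable_snd.
by move=> i j; exact: measurableT_comp (measurable_entry i j) measurable_fst.
Qed.

Lemma measurable_projected_cone A W :
  measurable [set u : borel 'rV[R]_3 | cone A (u *m W)].
Proof.
apply: measurable_cone_row; apply: measurable_row_mulmx.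
  exact: measurable_row_id.
by move=> i j; exact: measurable_cst.
Qed.

(** [H] stands for the planes meeting the cone outside 0 and [G'] for planes in general position.
    The planar formula is integrated over the planes, its last term by [projection_cone_measure]. *)
Lemma grassmann_angle_sections A (H G' : set (borel 'M[R]_3)) :
  measurable H -> measurable G' -> gamma 2%N G' = 1%E ->
  (forall w (W := 1%:M - w^T *m w)
      (E := [set u : borel 'rV[R]_3 | cone A `&` half_subspace W u <> [set 0]]),
    dot w w = 1 -> G' W -> measurable E /\
    fine (sigma E) = 2^-1 * \1_H W + fine (sigma [set u | cone A (u *m W)])) ->
  grassmann_angle gamma sigma 1 (cone A) =
    2^-1 * fine (gamma 2%N H) + fine (sigma (cone A)).
Proof.
move=> mH mG' G'1 sectE; have mT := measurable_projection_cone A.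
rewrite /grassmann_angle -projection_cone_measure.
pose T := [set p : borel 'M[R]_3 * borel 'rV[R]_3 | cone A (p.2 *m p.1)].
pose g (W : borel 'M[R]_3) := ((2^-1 * \1_H W)%:E + sigma (xsection T W))%E.
have m1 : measurable_fun setT
  (fun W : borel 'M[R]_3 => (2^-1 * \1_H W)%:E : \bar R).
  by apply/measurable_EFinP; apply: measurable_funM => //;
    exact: measurable_indic.
rewrite (@product_measure_sections _ _ _ _ _ _ _ _ g (G `&` G'))//;
  last 4 first.
- exact: measurableI.
- exact: probability_setI1.
- by move=> W; rewrite adde_ge0// lee_fin mulr_ge0.
- move=> W [GW G'W]; have [w ww WE] := plane_normal GW.
  rewrite WE in G'W *; have [mE Ew] := sectE w ww G'W.
  have xE (X : set (borel 'M[R]_3 * borel 'rV[R]_3)) V :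
      xsection X V = [set u | X (V, u)].
    by apply/seteqP; split=> u /xsectionP.
  rewrite /g !xE /= -(fineK (fin_num_measure sigma _ mE)) Ew EFinD fineK//.
  exact: (fin_num_measure sigma _ (measurable_projected_cone _ _)).
rewrite ge0_integralD//; last exact: measurable_fun_xsection.
rewrite -[X in fine (_ + X)]/((gamma 2%N \x sigma)%E T) -/T.
under eq_integral do rewrite EFinM.
rewrite ge0_integralZl//; last by apply/measurable_EFinP;
  exact: measurable_indic.
rewrite integral_indic// setIT fineD ?fineM//.
- exact: (fin_num_measure (gamma 2%N) _ mH).
- by rewrite fin_numM//; exact: (fin_num_measure (gamma 2%N) _ mH).
- pose mu : probability _ R := (gamma 2%N \x sigma)%E.
  exact: (fin_num_measure mu _ mT).
Qed.

(** Planes containing the edge direction [cross a b] are negligible, and every other plane meets the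
    wedge outside 0, so [H] is everything. *)
Lemma grassmann_angle_wedge a b : cross a b != 0 ->
  grassmann_angle gamma sigma 1 (cone [:: a; b]) =
    2^-1 + fine (sigma (cone [:: a; b])).
Proof.
move=> ab0; pose Z := [set W | normal_form W (cross a b) (cross a b) = 0].
have mZ : measurable (Z : set (borel 'M[R]_3)).
  by apply: measurable_eq0; exact: measurable_normal_form.
have -> : 2^-1 = 2^-1 * fine (gamma 2%N setT) :> R.
  by rewrite probability_setT mulr1.
apply: (@grassmann_angle_sections _ setT (~` Z)) => //;
  first exact: measurableC.
  by rewrite probability_setC// orthogonal_plane_null// sube0.
move=> w W E ww; rewrite /Z /= /W normal_formE -expr2 => /eqP.
rewrite sqrf_eq0 => abw; rewrite indicT mulr1.
exact: wedge_plane_measure.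
Qed.

(** For a plane of unit normal [w], [normal_form W N N] is the square of [dot N w]: the plane
    contains none of the vectors of [A]. *)
Definition transverse A : set (borel 'M[R]_3) :=
  [set W | forall N, N \in A -> normal_form W N N != 0].

Lemma measurable_transverse A : measurable (transverse A).
Proof.
elim: A => [|N A IH]; first by rewrite (_ : transverse _ = setT)//;
  apply/seteqP; split.
rewrite (_ : transverse _ = ~` [set W | normal_form W N N = 0] `&` transverse A).
  apply: measurableI => //; apply: measurableC; apply: measurable_eq0.
  exact: measurable_normal_form.
apply/seteqP; split => W /=.
  move=> WNA; split; first by apply/eqP/WNA; rewrite mem_head.
  by move=> N' N'A; apply: WNA; rewrite in_cons N'A orbT.
by move=> [/eqP WN WA] N'; rewrite in_cons => /predU1P[->//|/WA].
Qed.

Lemma transverse_full A : {in A, forall N, N != 0} ->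
  gamma 2%N (transverse A) = 1%E.
Proof.
elim: A => [_|N A IH A0].
  rewrite (_ : transverse _ = setT) ?probability_setT//.
  by apply/seteqP; split.
have mZ : measurable [set W : borel 'M[R]_3 | normal_form W N N = 0].
  by apply: measurable_eq0; exact: measurable_normal_form.
apply: probability_sup1
  (probability_setI1 (measurableC mZ) (measurable_transverse A) _ _).
- exact: measurable_transverse.
- by apply: measurableI; [exact: measurableC|exact: measurable_transverse].
- by move=> W [/= /eqP WN WA] N'; rewrite in_cons => /predU1P[->//|/WA].
- by rewrite probability_setC// orthogonal_plane_null ?sube0// A0// mem_head.
- by apply: IH => N' N'A; rewrite A0// in_cons N'A orbT.
Qed.

Lemma vertex_plane_measure A w a b (W := 1%:M - w^T *m w)
    (E := [set u : borel 'rV[R]_3 | cone A `&` half_subspace W u <> [set 0]]) :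
  dot w w = 1 -> dot (cross a b) w != 0 ->
  (forall x, dot x w = 0 -> cone A x <-> cone [:: a; b] x) ->
  measurable E /\
  fine (sigma E) = 2^-1 + fine (sigma [set u | cone A (u *m W)]).
Proof.
move=> ww abw A_ab.
rewrite (_ : E = [set u | cone [:: a; b] `&` half_subspace W u <> [set 0]]).
  rewrite (_ : [set u | cone A _] = [set u | cone [:: a; b] (u *m W)]).
    exact: wedge_plane_measure.
  apply/seteqP; split => u /=; rewrite mulmx_normal => /A_ab; apply;
    by rewrite dotBl dotZl ww mulr1 subrr.
apply/seteqP; split => u /=; move=> /half_planeP-/(_ ww)[x [x0 Ax xw xu]];
  by apply/half_planeP => //; exists x; split=> //; apply/A_ab.
Qed.

(* [d1], [d2], [d3] span the edges of the cone. If [w] has the same sign on them,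
   the plane only meets the cone at 0; otherwise one of the three inequalities is
   redundant on the plane, which cuts the cone like a wedge. *)
Lemma grassmann_angle_vertex a b c d1 d2 d3 :
  (forall x, x = dot a x *: d1 + dot b x *: d2 + dot c x *: d3) ->
  {in [:: d1; d2; d3; cross a b; cross b c; cross c a], forall N, N != 0} ->
  grassmann_angle gamma sigma 1 (cone [:: a; b; c]) =
    2^-1 * fine (gamma 2%N (~` [set W | 0 < normal_form W d1 d2 /\
                                        0 < normal_form W d1 d3])) +
    fine (sigma (cone [:: a; b; c])).
Proof.
move=> xE A0; have mZ : measurable [set W : borel 'M[R]_3 |
    0 < normal_form W d1 d2 /\ 0 < normal_form W d1 d3].
  by apply: measurableI; apply: measurable_gt0; exact: measurable_normal_form.
apply: (@grassmann_angle_sections _ _ _ (measurableC mZ) (measurable_transverse _)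
  (transverse_full A0)).
move=> w W E ww Wt.
have tr N : N \in [:: d1; d2; d3; cross a b; cross b c; cross c a] ->
  dot N w != 0.
  by move=> /Wt; rewrite normal_formE mulf_eq0 orbb.
have d1w : dot d1 w != 0 by apply: tr; rewrite !inE eqxx ?orbT.
have d2w : dot d2 w != 0 by apply: tr; rewrite !inE eqxx ?orbT.
have d3w : dot d3 w != 0 by apply: tr; rewrite !inE eqxx ?orbT.
have abw : dot (cross a b) w != 0 by apply: tr; rewrite !inE eqxx ?orbT.
have bcw : dot (cross b c) w != 0 by apply: tr; rewrite !inE eqxx ?orbT.
have caw : dot (cross c a) w != 0 by apply: tr; rewrite !inE eqxx ?orbT.
(* The values of [a], [b], [c] at [x] are its coordinates along the edges, and lying in the plane is
   one linear relation between them. *)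
have xw x : dot x w = 0 ->
    dot a x * dot d1 w + dot b x * dot d2 w + dot c x * dot d3 w = 0.
  by rewrite {1}(xE x) !dotDl !dotZl.
have zE : [set W | 0 < normal_form W d1 d2 /\ 0 < normal_form W d1 d3] W <->
    0 < dot d1 w * dot d2 w /\ 0 < dot d1 w * dot d3 w.
  by rewrite /= /W !normal_formE.
rewrite indicE in_setC; set Z := [set W | _] in zE mZ *.
have [WZ|WZ] := pselect (Z W).
  rewrite mem_set//= mulr0 add0r; have [s12 s13] := zE.1 WZ.
  have cone0 x : cone [:: a; b; c] x -> dot x w = 0 -> x = 0.
    move=> /cone3P[ax bx cx] /xw xw0; rewrite (xE x).
    have s23 : 0 < dot d2 w * dot d3 w by nra.
    have -> : dot a x = 0 by nra.
    have -> : dot b x = 0 by nra.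
    have -> : dot c x = 0 by nra.
    by rewrite !scale0r !addr0.
  rewrite (_ : E = set0); last first.
    apply/seteqP; split => // u /half_planeP-/(_ ww)[x [x0 Ax xw0 _]].
    by move/eqP: x0; apply; exact: cone0.
  split; first exact: measurable0.
  have [N N0 wN] := exists_orthogonal w.
  rewrite measure0/=; apply/esym/eqP; rewrite -fine0; apply/eqP; congr fine.
  have mZN : measurable [set v : borel 'rV[R]_3 | dot N v = 0].
    by apply: measurable_eq0; exact: measurable_dotl.
  apply: (subset_measure0 _ mZN) => //; last exact: plane_null.
    exact: measurable_projected_cone.
  move=> u /=; rewrite mulmx_normal => /cone0;
    rewrite dotBl dotZl ww mulr1 subrr.
  by move=> /(_ erefl)/subr0_eq ->; rewrite dotZr [dot N w]dotC wN mulr0.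
rewrite memNset//= mulr1.
have nZ : ~ (0 < dot d1 w * dot d2 w /\ 0 < dot d1 w * dot d3 w) by move=> /zE.
have d12 : dot d1 w * dot d2 w != 0 by rewrite mulf_neq0.
have d13 : dot d1 w * dot d3 w != 0 by rewrite mulf_neq0.
have d23 : dot d2 w * dot d3 w != 0 by rewrite mulf_neq0.
(* The edge whose sign differs from the other two has a redundant inequality: the relation writes
   its coordinate as a nonnegative combination of theirs. *)
have solve (s t r p q z : R) : s != 0 -> s * t < 0 -> s * r < 0 ->
    0 <= p -> 0 <= q -> s * z + t * p + r * q = 0 -> 0 <= z.
  move=> s0 st sr p0 q0 E0; have ss : 0 < s * s by rewrite -expr2
    exprn_even_gt0.
  have E1 : s * s * z = (- (s * t)) * p + (- (s * r)) * q.
    by rewrite -[LHS]subr0 -(mulr0 s) -E0; ring.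
  rewrite -(pmulr_rge0 z ss) E1.
  by apply: addr_ge0; apply: mulr_ge0 => //; rewrite oppr_ge0 ltW.
have pos_trans (s t r : R) : 0 < s * t -> 0 < t * r -> 0 < s * r.
  move=> st0 tr0; have t0 : t != 0 by apply: contraTneq st0 => ->;
    rewrite mulr0 ltxx.
  have t2 : 0 < t * t by rewrite -expr2 exprn_even_gt0.
  rewrite -(pmulr_rgt0 _ t2); have <- : (s * t) * (t * r) = (t * t) * (s * r)
    by ring.
  by rewrite mulr_gt0.
have [s23|s23] := ltP 0 (dot d2 w * dot d3 w).
  have s12 : dot d1 w * dot d2 w < 0.
    rewrite lt_neqAle d12 leNgt; apply/negP => s12; apply: nZ; split=> //.
    exact: pos_trans s12 s23.
  have s13 : dot d1 w * dot d3 w < 0.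
    rewrite lt_neqAle d13 leNgt; apply/negP => s13; apply: nZ; split=> //.
    by apply: pos_trans s13 _; rewrite mulrC.
  apply: (vertex_plane_measure ww bcw) => x /xw xw0; rewrite cone2P cone3P.
  split=> [[]//|[bx cx]]; split=> //.
  by apply: (solve _ _ _ _ _ _ d1w s12 s13 bx cx); rewrite -xw0; ring.
have s32 : dot d3 w * dot d2 w < 0 by rewrite mulrC lt_neqAle d23.
have [s12|s12] := ltP 0 (dot d1 w * dot d2 w).
  have s31 : dot d3 w * dot d1 w < 0.
    rewrite mulrC lt_neqAle d13 leNgt; apply/negP => s13; exact: nZ.
  apply: (vertex_plane_measure ww abw) => x /xw xw0; rewrite cone2P cone3P.
  split=> [[]//|[ax bx]]; split=> //.
  by apply: (solve _ _ _ _ _ _ d3w s31 s32 ax bx); rewrite -xw0; ring.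
have s21 : dot d2 w * dot d1 w < 0 by rewrite mulrC lt_neqAle d12.
have s23' : dot d2 w * dot d3 w < 0 by rewrite lt_neqAle d23.
apply: (vertex_plane_measure ww caw) => x /xw xw0; rewrite cone2P cone3P.
split=> [[]//|[cx ax]]; split=> //.
by apply: (solve _ _ _ _ _ _ d2w s21 s23' ax cx); rewrite -xw0; ring.
Qed.

End cone_angles.

(** * Angle sums of a tetrahedron *)

(** [same] is 1 at a value that has the three others on one side, which holds for the minimum and
    the maximum only. For the heights of the vertices over a plane, these are the two vertices whose
    cones the plane direction meets only at 0. *)
Lemma two_of_four_extremal (R : realDomainType) (w0 w1 w2 w3 : R) :
  uniq [:: w0; w1; w2; w3] ->
  let same (x y z : R) := ((0 < x * y) && (0 < x * z) : nat) in
  (same (w1 - w0)%R (w2 - w0)%R (w3 - w0)%R +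
   same (w0 - w1)%R (w2 - w1)%R (w3 - w1)%R +
   same (w0 - w2)%R (w1 - w2)%R (w3 - w2)%R +
   same (w0 - w3)%R (w1 - w3)%R (w2 - w3)%R = 2)%N.
Proof.
rewrite /= !inE !negb_or !andbT =>
  /and3P[/and3P[w01 w02 w03] /andP[w12 w13] w23].
have sg (x y z : R) : x != z -> y != z ->
    (0 < (x - z) * (y - z)) = ((z < x) == (z < y)).
  move=> xz yz; rewrite -(subr_gt0 z x) -(subr_gt0 z y).
  have : x - z != 0 by rewrite subr_eq0.
  have : y - z != 0 by rewrite subr_eq0.
  move: (x - z) (y - z) => {xz yz} {}x {}y y0 x0.
  have [x_gt0|x_le0] := ltP 0 x; first by rewrite pmulr_rgt0.
  have x_lt0 : x < 0 by rewrite lt_neqAle x0.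
  by rewrite nmulr_rgt0// eq_sym eqbF_neg -leNgt lt_neqAle y0.
rewrite !sg// ?[_ == w0]eq_sym// ?[_ == w1]eq_sym// ?[_ == w2]eq_sym//.
have ltC (x y : R) : x != y -> (y < x) = ~~ (x < y).
  by move=> xy; rewrite -leNgt le_eqVlt eq_sym (negbTE xy).
rewrite (ltC w0 w1)// (ltC w0 w2)// (ltC w0 w3)// (ltC w1 w2)// (ltC w1 w3)//.
rewrite (ltC w2 w3)//.
have T x y z : x < y -> y < z -> x < z by exact: lt_trans.
case: ltP => h01; case: ltP => h02; case: ltP => h03; case: ltP => h12;
  case: ltP => h13; case: ltP => h23 //=; exfalso; lra.
Qed.

Section tetrahedron.
Variable R : realType.
Variables (gamma : nat -> probability (borel 'M[R]_3) R)
          (sigma : probability (borel 'rV[R]_3) R).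
Hypothesis hgamma : haar_grassmannian 2 (gamma 2%N).
Hypothesis hsigma : uniform_sphere sigma.
(** [dot n_i] is the linear part of the barycentric coordinate of [p_i]. The tangent cone at [p_i]
    is thus cut out by the three other normals, and the cone along an edge by the two normals of the
    facets through it. *)
Variables n0 n1 n2 n3 p0 p1 p2 p3 : 'rV[R]_3.
Hypothesis sum_n : forall x, dot n0 x + dot n1 x + dot n2 x + dot n3 x = 0.
Hypothesis decomposition : forall x,
  x = dot n0 x *: p0 + dot n1 x *: p1 + dot n2 x *: p2 + dot n3 x *: p3.
Hypothesis edges_neq0 :
  {in [:: p1 - p0; p2 - p0; p3 - p0; p2 - p1; p3 - p1; p3 - p2], forall d, d != 0}.
Hypothesis wedges_neq0 :
  {in [:: cross n0 n1; cross n0 n2; cross n0 n3; cross n1 n2; cross n1 n3; cross n2 n3],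
    forall d, d != 0}.
Implicit Types (l : seq 'rV[R]_3).

Local Notation angle l := (grassmann_angle gamma sigma 1 (cone l)).
Local Notation solid l := (fine (sigma (cone l))).

Lemma cone_all l (x : 'rV[R]_3) : `[< cone l x >] = all (fun N => 0 <= dot N x) l.
Proof.
by apply/asboolP/allP => lx N Nl; exact: lx.
Qed.

Lemma neq0_n : [/\ n0 != 0, n1 != 0, n2 != 0 & n3 != 0].
Proof.
have cl (a b : 'rV[R]_3) : cross a b != 0 -> a != 0 /\ b != 0.
  move=> ab; split; apply: contra_neq ab => ->;
    by apply: dot_inj => u; rewrite !vec_simp !mxE; ring.
have /cl[? ?] : cross n0 n1 != 0 by apply: wedges_neq0; rewrite !inE eqxx ?orbT.
have /cl[? ?] : cross n2 n3 != 0 by apply: wedges_neq0; rewrite !inE eqxx ?orbT.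
by [].
Qed.

(* Gram's relation. A nonzero [x] violates one of the four inequalities and
   satisfies another, so the alternating sum of the indicators vanishes at [x]. *)
Lemma gram_relation :
  solid [:: n0; n1] + solid [:: n0; n2] + solid [:: n0; n3] +
  solid [:: n1; n2] + solid [:: n1; n3] + solid [:: n2; n3] =
  solid [:: n1; n2; n3] + solid [:: n0; n2; n3] + solid [:: n0; n1; n3] +
  solid [:: n0; n1; n2] + 1.
Proof.
have [n00 n10 n20 n30] := neq0_n.
have mC l : measurable (cone l : set (borel 'rV[R]_3)).
  exact: measurable_cone_row (@measurable_row_id R).
have half N : N != 0 -> solid [:: N] = 2^-1.
  move=> N0; rewrite -(closed_halfspace_half hsigma N0); congr (fine (sigma _)).
  by apply/seteqP; split => x /cone1P.
have full : solid [::] = 1.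
  rewrite (_ : cone [::] = setT) ?probability_setT//.
  by apply/seteqP; split => x // _ N.
(* Even families of inequalities against odd ones. The empty family contributes 1 and the four
   half-spaces 2, whence the constant 1; the family of all four cuts out only 0 and is left out. *)
have : \sum_(l <- [:: [::]; [:: n0; n1]; [:: n0; n2]; [:: n0; n3]; [:: n1; n2];
                     [:: n1; n3]; [:: n2; n3]]) solid l =
       \sum_(l <- [:: [:: n0]; [:: n1]; [:: n2]; [:: n3]; [:: n1; n2; n3];
                     [:: n0; n2; n3]; [:: n0; n1; n3];
                       [:: n0; n1; n2]]) solid l.
  apply: (@sum_probability_eq _ _ _ sigma (unit_sphere R) _ _ _ _ xpredT xpredT
    (@cone R) (@cone R) (@measurable_unit_sphere R) hsigma.1) => // x x1.
  rewrite !big_cons !big_nil !indic_asbool !cone_all /= !andbT !addr0 -!natrD.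
  congr (_%:R).
  have := sum_n x; have [b0|b0] := leP 0 (dot n0 x); have [b1|b1] :=
    leP 0 (dot n1 x);
    have [b2|b2] := leP 0 (dot n2 x); have [b3|b3] :=
      leP 0 (dot n3 x) => //= S0;
    exfalso; last by lra.
  have x0 := unit_sphere_neq0 x1; move/eqP: x0; apply;
    rewrite (decomposition x).
  have -> : dot n0 x = 0 by lra.
  have -> : dot n1 x = 0 by lra.
  have -> : dot n2 x = 0 by lra.
  have -> : dot n3 x = 0 by lra.
  by rewrite !scale0r !addr0.
rewrite !big_cons !big_nil !half// full; lra.
Qed.

Let Z (d1 d2 d3 : 'rV[R]_3) : set (borel 'M[R]_3) :=
  [set W | 0 < normal_form W d1 d2 /\ 0 < normal_form W d1 d3].

Let mZ d1 d2 d3 : measurable (Z d1 d2 d3).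
Proof.
by apply: measurableI; apply: measurable_gt0; exact: measurable_normal_form.
Qed.

(** Along the normal of [W], the events [Z] single out the lowest and the highest vertex, where [W]
    misses the cone outside 0. *)
Lemma vertices_hit :
  fine (gamma 2%N (Z (p1 - p0) (p2 - p0) (p3 - p0))) +
  fine (gamma 2%N (Z (p0 - p1) (p2 - p1) (p3 - p1))) +
  fine (gamma 2%N (Z (p0 - p2) (p1 - p2) (p3 - p2))) +
  fine (gamma 2%N (Z (p0 - p3) (p1 - p3) (p2 - p3))) = 2.
Proof.
have : \sum_(d <- [:: (p1 - p0, p2 - p0, p3 - p0); (p0 - p1, p2 - p1, p3 - p1);
                      (p0 - p2, p1 - p2, p3 - p2); (p0 - p3, p1 - p3, p2 - p3)])
         fine (gamma 2%N (Z d.1.1 d.1.2 d.2)) =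
       \sum_(b : bool) fine (gamma 2%N setT).
  pose G := (grassmannian R 2 : set (borel 'M[R]_3)) `&`
    transverse [:: p1 - p0; p2 - p0; p3 - p0; p2 - p1; p3 - p1; p3 - p2].
  have mG : measurable G.
    by apply: measurableI;
      [exact: measurable_grassmannian|exact: measurable_transverse].
  have G1 : gamma 2%N G = 1%E.
    apply: probability_setI1; [exact: measurable_grassmannian|
      exact: measurable_transverse|exact: hgamma.1|exact: transverse_full].
  apply: (@sum_probability_eq _ _ _ (gamma 2%N) G _ _ _ _ xpredT xpredT
    (fun d => Z d.1.1 d.1.2 d.2) (fun=> setT) mG G1) => //.
  move=> W [GW Wt]; have [w ww WE] := plane_normal GW.
  rewrite !big_cons big_nil big_bool !indic_asbool /= !asbool_and !asboolb.
  rewrite asboolT// WE !normal_formE !dotBl addr0 -!natrD; congr (_%:R).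
  rewrite !addnA; apply: two_of_four_extremal.
  have tr p q : q - p \in
    [:: p1 - p0; p2 - p0; p3 - p0; p2 - p1; p3 - p1; p3 - p2] ->
      dot p w != dot q w.
    by move=> /Wt; rewrite WE normal_formE mulf_eq0 orbb dotBl subr_eq0 eq_sym.
  rewrite /= !inE !negb_or !tr ?inE ?eqxx ?orbT//.
rewrite !big_cons big_nil big_bool probability_setT /=; lra.
Qed.

Lemma vertex_angles_sum :
  angle [:: n1; n2; n3] + angle [:: n0; n2; n3] + angle [:: n0; n1; n3] +
  angle [:: n0; n1; n2] =
  solid [:: n1; n2; n3] + solid [:: n0; n2; n3] + solid [:: n0; n1; n3] +
  solid [:: n0; n1; n2] + 1.
Proof.
have crossN (a b : 'rV[R]_3) : cross a b != 0 -> cross b a != 0.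
  by rewrite crossNC oppr_eq0.
have subN (a b : 'rV[R]_3) : a - b != 0 -> b - a != 0.
  by rewrite -oppr_eq0 opprB.
have nZ d1 d2 d3 : fine (gamma 2%N (~` Z d1 d2 d3)) = 1 - fine
  (gamma 2%N (Z d1 d2 d3)).
  by rewrite probability_setC// fineB ?fin_num_measure.
have c01 : cross n0 n1 != 0 by apply: wedges_neq0; rewrite !inE eqxx ?orbT.
have c02 : cross n0 n2 != 0 by apply: wedges_neq0; rewrite !inE eqxx ?orbT.
have c03 : cross n0 n3 != 0 by apply: wedges_neq0; rewrite !inE eqxx ?orbT.
have c12 : cross n1 n2 != 0 by apply: wedges_neq0; rewrite !inE eqxx ?orbT.
have c13 : cross n1 n3 != 0 by apply: wedges_neq0; rewrite !inE eqxx ?orbT.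
have c23 : cross n2 n3 != 0 by apply: wedges_neq0; rewrite !inE eqxx ?orbT.
have e10 : p1 - p0 != 0 by apply: edges_neq0; rewrite !inE eqxx ?orbT.
have e20 : p2 - p0 != 0 by apply: edges_neq0; rewrite !inE eqxx ?orbT.
have e30 : p3 - p0 != 0 by apply: edges_neq0; rewrite !inE eqxx ?orbT.
have e21 : p2 - p1 != 0 by apply: edges_neq0; rewrite !inE eqxx ?orbT.
have e31 : p3 - p1 != 0 by apply: edges_neq0; rewrite !inE eqxx ?orbT.
have e32 : p3 - p2 != 0 by apply: edges_neq0; rewrite !inE eqxx ?orbT.
have n0E x : dot n0 x = - (dot n1 x + dot n2 x + dot n3 x) by have := sum_n x; lra.
have n1E x : dot n1 x = - (dot n0 x + dot n2 x + dot n3 x) by have := sum_n x; lra.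
have n2E x : dot n2 x = - (dot n0 x + dot n1 x + dot n3 x) by have := sum_n x; lra.
have n3E x : dot n3 x = - (dot n0 x + dot n1 x + dot n2 x) by have := sum_n x; lra.
rewrite (@grassmann_angle_vertex _ _ _ hgamma hsigma n1 n2 n3 (p1 - p0) (p2 - p0) (p3 - p0)); last 2 first.
- move=> x; rewrite {1}(decomposition x) n0E; apply/rowP => j; rewrite !mxE; ring.
- by apply/allP => /=; rewrite c12 c23 (crossN _ _ c13) e10 e20 e30.
rewrite (@grassmann_angle_vertex _ _ _ hgamma hsigma n0 n2 n3 (p0 - p1) (p2 - p1) (p3 - p1)); last 2 first.
- move=> x; rewrite {1}(decomposition x) n1E; apply/rowP => j; rewrite !mxE; ring.
- by apply/allP => /=; rewrite c02 c23 (crossN _ _ c03) (subN _ _ e10) e21 e31.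
rewrite (@grassmann_angle_vertex _ _ _ hgamma hsigma n0 n1 n3 (p0 - p2) (p1 - p2) (p3 - p2)); last 2 first.
- move=> x; rewrite {1}(decomposition x) n2E; apply/rowP => j; rewrite !mxE; ring.
- by apply/allP => /=; rewrite c01 c13 (crossN _ _ c03) (subN _ _ e20)
  (subN _ _ e21) e32.
rewrite (@grassmann_angle_vertex _ _ _ hgamma hsigma n0 n1 n2 (p0 - p3) (p1 - p3) (p2 - p3)); last 2 first.
- move=> x; rewrite {1}(decomposition x) n3E; apply/rowP => j; rewrite !mxE; ring.
- by apply/allP => /=; rewrite c01 c12 (crossN _ _ c02) (subN _ _ e30)
  (subN _ _ e31) (subN _ _ e32).
rewrite !nZ; have := vertices_hit; lra.
Qed.

Lemma edge_angles_sum :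
  angle [:: n0; n1] + angle [:: n0; n2] + angle [:: n0; n3] +
  angle [:: n1; n2] + angle [:: n1; n3] + angle [:: n2; n3] =
  solid [:: n1; n2; n3] + solid [:: n0; n2; n3] + solid [:: n0; n1; n3] +
  solid [:: n0; n1; n2] + 4.
Proof.
rewrite !(grassmann_angle_wedge hgamma hsigma)//;
  try by apply: wedges_neq0; rewrite !inE eqxx ?orbT.
have := gram_relation; lra.
Qed.

End tetrahedron.

(** * Polyhedra and convex hulls *)

Section polyhedra.
Variable R : realType.
Implicit Types (x y v : 'rV[R]_3) (L : seq (R * 'rV[R]_3)).

Definition polyhedron L : set 'rV[R]_3 :=
  [set x | forall q, q \in L -> 0 <= q.1 + dot q.2 x].

Lemma polyhedron_convex L : @convex_set R 'rV[R]_3 (polyhedron L).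
Proof.
move=> x y l; rewrite !inE => Lx Ly q qL.
have l0 : 0 <= l%:num by [].
have l1 : 0 <= 1 - l%:num by rewrite subr_ge0.
rewrite -[conv _ _ _]/(l%:num *: (x : 'rV[R]_3) + (1 - l%:num) *: (y : 'rV[R]_3)).
rewrite dotDr !dotZr; have -> : q.1 +
  (l%:num * dot q.2 x + (1 - l%:num) * dot q.2 y) =
    l%:num * (q.1 + dot q.2 x) + (1 - l%:num) * (q.1 + dot q.2 y) by ring.
by rewrite addr_ge0// mulr_ge0//; [exact: Lx|exact: Ly].
Qed.

(** Active constraints hold along the direction by assumption, and inactive ones tolerate a short
    step. The induction keeps the whole segment, so that [e] may shrink at each new constraint. *)
Lemma polyhedron_segment L v y : polyhedron L v ->
  (forall q, q \in L -> q.1 + dot q.2 v = 0 -> 0 <= dot q.2 y) ->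
  exists2 e : R, 0 < e & polyhedron L (v + e *: y).
Proof.
move=> Lv Ly; suff [e e0 Le] : exists2 e : R, 0 < e &
    forall t, 0 <= t <= e -> polyhedron L (v + t *: y).
  by exists e => //; apply: Le; rewrite lexx ltW.
elim: L Lv Ly => [|q L IH] Lv Ly; first by exists 1.
have [||e e0 Le] := IH.
- by move=> p pL; apply: Lv; rewrite in_cons pL orbT.
- by move=> p pL; apply: Ly; rewrite in_cons pL orbT.
have := Lv q (mem_head _ _); rewrite le_eqVlt => /predU1P[/esym q0|q_gt0].
  exists e => // t te p; rewrite in_cons => /predU1P[->|/(Le t te)//].
  rewrite dotDr addrA q0 add0r dotZr mulr_ge0 ?(Ly _ (mem_head _ _))//.
  by case/andP: te.
have y1 : 0 < 1 + `|dot q.2 y| by rewrite ltr_wpDr.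
exists (Num.min e ((q.1 + dot q.2 v) / (1 + `|dot q.2 y|))).
  by rewrite lt_min e0 divr_gt0.
move=> t /andP[t0]; rewrite le_min => /andP[te tq] p.
rewrite in_cons => /predU1P[->|]; last by apply: Le; rewrite t0.
rewrite dotDr addrA dotZr; move: tq; rewrite ler_pdivlMr// => tq.
have : - (t * dot q.2 y) <= t * (1 + `|dot q.2 y|).
  by rewrite -mulrN ler_wpM2l// -normrN (le_trans (ler_norm _))// lerDr.
by move: (dot q.2 y) tq => d; lra.
Qed.

Lemma tangent_cone_polyhedron L v : polyhedron L v ->
  tangent_cone (polyhedron L) v =
  cone [seq q.2 | q <- L & q.1 + dot q.2 v == 0].
Proof.
move=> Lv; apply/seteqP; split => y.
  move=> [x Lx [l l0 ->]] _ /mapP[q + ->].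
  rewrite mem_filter => /andP[/eqP qv qL]; rewrite dotZr mulr_ge0// dotBr.
  by have := Lx q qL; lra.
move=> Ly; have [q qL qv|e e0 Le] := @polyhedron_segment L v y Lv.
  by apply: Ly; apply/mapP; exists q => //; rewrite mem_filter qv eqxx.
exists (v + e *: y) => //; exists e^-1; first by rewrite invr_ge0 ltW.
by rewrite addrC addKr scalerA mulVf ?gt_eqF// scale1r.
Qed.

End polyhedra.

Section convex_hulls.
Variable R : realType.
Implicit Types (x y v : 'rV[R]_3) (A : set 'rV[R]_3).

Lemma convex_setP A x y (l : R) : @convex_set R 'rV[R]_3 A -> A x -> A y ->
  0 <= l -> l <= 1 -> A (l *: x + (1 - l) *: y).
Proof.
move=> cA Ax Ay l0 l1; have := cA x y (Itv01 l0 l1).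
by rewrite !inE; apply.
Qed.

Lemma convex_hull_convex A : @convex_set R 'rV[R]_3 (convex_hull A).
Proof.
move=> x y l; rewrite !inE => Ax Ay B [cB AB].
by have := cB x y l; rewrite !inE; apply; [exact: Ax|exact: Ay].
Qed.

(* [(s, z)] in the cone over [A] at height 1. *)
Let above A (s : R) z := (s = 0 /\ z = 0) \/ (0 < s /\ A (s^-1 *: z)).

Let aboveZ A s x : A x -> 0 <= s -> above A s (s *: x).
Proof.
move=> Ax; rewrite le_eqVlt => /predU1P[<-|s0]; first by left; rewrite scale0r.
by right; rewrite scalerA mulVf ?scale1r// gt_eqF.
Qed.

Let aboveD A s t z y : @convex_set R 'rV[R]_3 A ->
  above A s z -> above A t y -> above A (s + t) (z + y).
Proof.
move=> cA [[-> ->]|[s0 Az]]; first by rewrite !add0r.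
move=> [[-> ->]|[t0 Ay]]; first by rewrite !addr0; right.
right; have st0 : 0 < s + t by rewrite addr_gt0.
have [s_n0 t_n0 st_n0] : [/\ s != 0, t != 0 & s + t != 0] by rewrite !gt_eqF.
split=> //; have := convex_setP cA Az Ay (l := s / (s + t)).
have -> : 1 - s / (s + t) = t / (s + t) by field.
rewrite !scalerA (_ : s / (s + t) * s^-1 = (s + t)^-1); last by field;
  rewrite s_n0 st_n0.
rewrite (_ : t / (s + t) * t^-1 = (s + t)^-1); last by field;
  rewrite t_n0 st_n0.
rewrite scalerDr; apply; first by rewrite divr_ge0 ?ltW.
by rewrite ler_pdivrMr// mul1r lerDl ltW.
Qed.

(** The weighted points are added in the cone over the hull, where partial sums of weights are
    arbitrary and may vanish; only the total has height 1. *)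
Lemma convex_hull4 A (p0 p1 p2 p3 : 'rV[R]_3) (b0 b1 b2 b3 : R) :
  A p0 -> A p1 -> A p2 -> A p3 ->
  0 <= b0 -> 0 <= b1 -> 0 <= b2 -> 0 <= b3 -> b0 + b1 + b2 + b3 = 1 ->
  convex_hull A (b0 *: p0 + b1 *: p1 + b2 *: p2 + b3 *: p3).
Proof.
move=> Ap0 Ap1 Ap2 Ap3 b0_ge0 b1_ge0 b2_ge0 b3_ge0 b1E.
have cA := @convex_hull_convex A; have Ah : A `<=` convex_hull A by exact:
  sub_gen_smallest.
have := aboveD cA (aboveD cA (aboveD cA (aboveZ (Ah _ Ap0) b0_ge0)
  (aboveZ (Ah _ Ap1) b1_ge0)) (aboveZ (Ah _ Ap2) b2_ge0)) (aboveZ (Ah _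
    Ap3) b3_ge0).
rewrite b1E => -[[/eqP]|[_]]; first by rewrite oner_eq0.
by rewrite invr1 scale1r.
Qed.

End convex_hulls.

(** * The Reeve tetrahedron *)

Section reeve_tetrahedron.
Variable R : realType.
Variable h : nat.
Hypothesis h_gt0 : (0 < h)%N.
Implicit Types (x y v : 'rV[R]_3).

Local Notation H := (h%:R : R).

Let H_neq0 : H != 0. Proof. by rewrite pnatr_eq0 -lt0n. Qed.
Let H_gt0 : 0 < H. Proof. by rewrite ltr0n. Qed.

(* [p_i] is the vertex opposite to the facet of inner normal [n_i], normalized so
   that [dot n_i] is the linear part of the barycentric coordinate of [p_i]. *)
Let p0 : 'rV[R]_3 := point3 0 0 0.
Let p1 : 'rV[R]_3 := point3 0 1 0.
Let p2 : 'rV[R]_3 := point3 1 0 0.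
Let p3 : 'rV[R]_3 := point3 1 1 H.
Let n0 : 'rV[R]_3 := point3 (-1) (-1) H^-1.
Let n1 : 'rV[R]_3 := point3 0 1 (- H^-1).
Let n2 : 'rV[R]_3 := point3 1 0 (- H^-1).
Let n3 : 'rV[R]_3 := point3 0 0 H^-1.

Definition reeve_normals : seq 'rV[R]_3 := [:: n0; n1; n2; n3].

Definition reeve_facets (t : R) : seq (R * 'rV[R]_3) :=
  [:: (t, n0); (0, n1); (0, n2); (0, n3)].

Lemma polyhedron_reeve t x : polyhedron (reeve_facets t) x <->
  [/\ 0 <= t + dot n0 x, 0 <= dot n1 x, 0 <= dot n2 x & 0 <= dot n3 x].
Proof.
split=> [tx|[x0 x1 x2 x3] q].
  split; [by apply: (tx (t, n0)); rewrite !inE eqxx|rewrite -[leRHS]add0r..].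
  - by apply: (tx (0, n1)); rewrite !inE eqxx ?orbT.
  - by apply: (tx (0, n2)); rewrite !inE eqxx ?orbT.
  - by apply: (tx (0, n3)); rewrite !inE eqxx ?orbT.
by rewrite !inE => /or4P[] /eqP->/=; rewrite ?add0r.
Qed.

Lemma reeve_sum_normals x : dot n0 x + dot n1 x + dot n2 x + dot n3 x = 0.
Proof. by rewrite !vec_simp; field. Qed.

Lemma reeve_decomposition x :
  x = dot n0 x *: p0 + dot n1 x *: p1 + dot n2 x *: p2 + dot n3 x *: p3.
Proof. by apply: row3P; rewrite !mxE /= !vec_simp; field. Qed.

Lemma coord_neq0 x j (r : R) : r != 0 -> x 0 j = r -> x != 0.
Proof. by move=> r0 xj; apply: contra_neq r0 => x0; rewrite -xj x0 mxE. Qed.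

Lemma reeve_edges_neq0 :
  {in [:: p1 - p0; p2 - p0; p3 - p0; p2 - p1; p3 - p1; p3 - p2], forall d, d != 0}.
Proof.
have e10 : p1 - p0 != 0.
  by apply: (coord_neq0 (j := 1) (oner_neq0 R)); rewrite !mxE /=; ring.
have e20 : p2 - p0 != 0.
  by apply: (coord_neq0 (j := 0) (oner_neq0 R)); rewrite !mxE /=; ring.
have e30 : p3 - p0 != 0.
  by apply: (coord_neq0 (j := 0) (oner_neq0 R)); rewrite !mxE /=; ring.
have e21 : p2 - p1 != 0.
  by apply: (coord_neq0 (j := 0) (oner_neq0 R)); rewrite !mxE /=; ring.
have e31 : p3 - p1 != 0.
  by apply: (coord_neq0 (j := 0) (oner_neq0 R)); rewrite !mxE /=; ring.
have e32 : p3 - p2 != 0.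
  by apply: (coord_neq0 (j := 1) (oner_neq0 R)); rewrite !mxE /=; ring.
by apply/allP; rewrite /= e10 e20 e30 e21 e31 e32.
Qed.

Lemma reeve_wedges_neq0 :
  {in [:: cross n0 n1; cross n0 n2; cross n0 n3; cross n1 n2; cross n1 n3; cross n2 n3],
    forall d, d != 0}.
Proof.
have m1 : -1 != 0 :> R by rewrite oppr_eq0 oner_eq0.
have Hi : H^-1 != 0 by rewrite invr_eq0.
have mHi : - H^-1 != 0 by rewrite oppr_eq0.
have c01 : cross n0 n1 != 0.
  by apply: (coord_neq0 (j := 2) m1); rewrite !vec_simp; ring.
have c02 : cross n0 n2 != 0.
  by apply: (coord_neq0 (j := 2) (oner_neq0 R)); rewrite !vec_simp; ring.
have c03 : cross n0 n3 != 0.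
  by apply: (coord_neq0 (j := 0) mHi); rewrite !vec_simp; ring.
have c12 : cross n1 n2 != 0.
  by apply: (coord_neq0 (j := 2) m1); rewrite !vec_simp; ring.
have c13 : cross n1 n3 != 0.
  by apply: (coord_neq0 (j := 0) Hi); rewrite !vec_simp; ring.
have c23 : cross n2 n3 != 0.
  by apply: (coord_neq0 (j := 1) mHi); rewrite !vec_simp; ring.
by apply/allP; rewrite /= c01 c02 c03 c12 c13 c23.
Qed.

Lemma reeve_barycentric x :
  x = (1 + dot n0 x) *: p0 + dot n1 x *: p1 + dot n2 x *: p2 + dot n3 x *: p3.
Proof.
have p00 : p0 = 0 by apply: row3P; rewrite !mxE.
by rewrite {1}(reeve_decomposition x) p00 !scaler0.
Qed.

Lemma reeveE : reeve R h = polyhedron (reeve_facets 1).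
Proof.
apply/seteqP; split.
  apply: smallest_sub; first exact: polyhedron_convex.
  move=> x /=; rewrite !inE => /or4P[] /eqP->; apply/polyhedron_reeve;
    rewrite !vec_simp ?mulNr ?mulVf//; split; lra.
move=> x /polyhedron_reeve[x0 x1 x2 x3].
rewrite (reeve_barycentric x); apply: convex_hull4 => //=;
  rewrite ?inE ?eqxx ?orbT//.
by have := reeve_sum_normals x; lra.
Qed.

Lemma dilate_reeve n : (0 < n)%N ->
  dilate n (reeve R h) = polyhedron (reeve_facets n%:R).
Proof.
move=> n_gt0; have n_neq0 : n%:R != 0 :> R by rewrite pnatr_eq0 -lt0n.
have {}n_gt0 : 0 < n%:R :> R by rewrite ltr0n.
rewrite reeveE; apply/seteqP; split => x.
  move=> [y /polyhedron_reeve[y0 y1 y2 y3] <-]; apply/polyhedron_reeve.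
  rewrite !dotZr -{1}[n%:R]mulr1 -mulrDr.
  by split; apply: mulr_ge0 => //; exact: ltW.
move=> /polyhedron_reeve[x0 x1 x2 x3]; exists (n%:R^-1 *: x); last first.
  by rewrite scalerA mulfV// scale1r.
apply/polyhedron_reeve; rewrite !dotZr -{1}(mulVf n_neq0) -mulrDr.
by split; apply: mulr_ge0 => //; rewrite invr_ge0 ltW.
Qed.

(** If [v] is none of the [p_i], the strict inequalities [dot c p_i < dot c v], averaged with the
    barycentric weights of [v], are contradictory. Conversely [n_i] exposes [p_i]. *)
Lemma vertices_reeve : vertices (reeve R h) = [set` [:: p0; p1; p2; p3]].
Proof.
rewrite reeveE; apply/seteqP; split => v /=.
  move=> [/[dup] vP /polyhedron_reeve[v0 v1 v2 v3] [c cv]].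
  apply: contrapT => /negP; rewrite !inE !negb_or =>
    /and4P[/eqP vp0 /eqP vp1 /eqP vp2 /eqP vp3].
  have pP q : q \in [:: p0; p1; p2; p3] -> polyhedron (reeve_facets 1) q.
    by rewrite -reeveE => qp; apply: sub_gen_smallest; exact: qp.
  have c0 : dot c p0 < dot c v.
    by apply: cv; [apply: pP; rewrite !inE eqxx|move=> E; exact: vp0].
  have c1 : dot c p1 < dot c v.
    by apply: cv; [apply: pP; rewrite !inE eqxx ?orbT|move=> E; exact: vp1].
  have c2 : dot c p2 < dot c v.
    by apply: cv; [apply: pP; rewrite !inE eqxx ?orbT|move=> E; exact: vp2].
  have c3 : dot c p3 < dot c v.
    by apply: cv; [apply: pP; rewrite !inE eqxx ?orbT|move=> E; exact: vp3].
  have := congr1 (dot c) (reeve_barycentric v); rewrite !dotDr !dotZr => E.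
  have zero b k : 0 <= b -> k < dot c v -> b * (dot c v - k) <= 0 -> b = 0.
    by move=> b0 kv; rewrite pmulr_lle0 ?subr_gt0// => b1; apply/eqP;
      rewrite eq_le b1.
  have b_ge0 b k : 0 <= b -> k < dot c v -> 0 <= b * (dot c v - k).
    by move=> b0 kv; rewrite mulr_ge0// subr_ge0 ltW.
  have q0 := b_ge0 _ _ v0 c0; have q1 := b_ge0 _ _ v1 c1.
  have q2 := b_ge0 _ _ v2 c2; have q3 := b_ge0 _ _ v3 c3.
  have S := reeve_sum_normals v.
  have M : dot c v = (1 + dot n0 v) * dot c v + dot n1 v * dot c v + dot n2 v *
    dot c v
                     + dot n3 v * dot c v.
    by rewrite -[LHS]mul1r -{1}[1]addr0 -S; ring.
  have b0 : 1 + dot n0 v = 0 by apply: (zero _ _ v0 c0); lra.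
  have b1 : dot n1 v = 0 by apply: (zero _ _ v1 c1); lra.
  have b2 : dot n2 v = 0 by apply: (zero _ _ v2 c2); lra.
  have b3 : dot n3 v = 0 by apply: (zero _ _ v3 c3); lra.
  by lra.
move=> vp; split; first by rewrite -reeveE; apply: sub_gen_smallest; exact: vp.
have expose N p : (forall x, polyhedron (reeve_facets 1) x -> dot N p <= dot N x -> x = p) ->
    exists c, forall x, polyhedron (reeve_facets 1) x -> x <> p ->
      dot c x < dot c p.
  move=> Np; exists N => x Lx xp; rewrite ltNge; apply/negP => Nx.
  by apply: xp; exact: Np.
have d0 : dot n0 p0 = 0 by rewrite !vec_simp; ring.
have d1 : dot n1 p1 = 1 by rewrite !vec_simp; ring.
have d2 : dot n2 p2 = 1 by rewrite !vec_simp; ring.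
have d3 : dot n3 p3 = 1 by rewrite !vec_simp; field.
move: vp; rewrite !inE => /or4P[] /eqP->;
  [apply: (expose n0)|apply: (expose n1)|apply: (expose n2)|apply: (expose n3)];
  move=> x /polyhedron_reeve[x0 x1 x2 x3]; rewrite ?d0 ?d1 ?d2 ?d3 => le;
  have S := reeve_sum_normals x; rewrite (reeve_barycentric x).
- have -> : 1 + dot n0 x = 1 by lra.
  have -> : dot n1 x = 0 by lra.
  have -> : dot n2 x = 0 by lra.
  have -> : dot n3 x = 0 by lra.
  by rewrite !scale0r scale1r !addr0.
- have -> : 1 + dot n0 x = 0 by lra.
  have -> : dot n1 x = 1 by lra.
  have -> : dot n2 x = 0 by lra.
  have -> : dot n3 x = 0 by lra.
  by rewrite !scale0r scale1r !addr0 add0r.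
- have -> : 1 + dot n0 x = 0 by lra.
  have -> : dot n1 x = 0 by lra.
  have -> : dot n2 x = 1 by lra.
  have -> : dot n3 x = 0 by lra.
  by rewrite !scale0r scale1r !addr0 !add0r.
- have -> : 1 + dot n0 x = 0 by lra.
  have -> : dot n1 x = 0 by lra.
  have -> : dot n2 x = 0 by lra.
  have -> : dot n3 x = 1 by lra.
  by rewrite !scale0r scale1r !add0r.
Qed.

End reeve_tetrahedron.

(** * Sums over compositions *)

Section compositions.
Variable R : realFieldType.

(* The sum of [f (q == 0) (i == 0) (j == 0) (l == 0)] over the compositions
   [q + i + j + l = m] into four natural numbers. *)
Definition composition4_sum (m : nat) (f : bool -> bool -> bool -> bool -> R) : R :=
  \sum_(q < m.+1) \sum_(i < (m - q).+1) \sum_(j < (m - q - i).+1)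
    f (q == 0 :> nat)%N (i == 0 :> nat)%N (j == 0 :> nat)%N
      (m - q - i - j == 0)%N.

(** The terms where this part or the remainder is 0 are split off, since only there do the booleans
    change; the others are reindexed by the remainder. *)
Lemma sum_ord_ends k (G : bool -> nat -> R) :
  \sum_(i < k.+2) G (i == 0 :> nat)%N (k.+1 - i)%N =
  G true k.+1 + \sum_(l < k) G false l.+1 + G false 0%N.
Proof.
rewrite big_ord_recl big_ord_recr /= subn0 addrA; congr (_ + _ + G false _).
  rewrite (reindex_inj rev_ord_inj) /=; apply: eq_bigr => l _;
    congr (G false _).
  by rewrite /bump /= add1n subSS subKn.
by rewrite /bump /= add1n subnn.
Qed.

(** The hockey-stick identity, with binomial coefficients written as polynomials. *)
Lemma sum_ord_binomial k (a b c : R) :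
  \sum_(l < k) (a + l%:R * b + l%:R * (l%:R - 1) / 2 * c) =
  k%:R * a + k%:R * (k%:R - 1) / 2 * b + k%:R * (k%:R - 1) * (k%:R - 2) / 6 * c.
Proof.
elim: k => [|k IH]; first by rewrite big_ord0 !mul0r !addr0.
by rewrite big_ord_recr /= IH -natr1; field.
Qed.

(** Grouping by the set of nonzero parts: [k.+1] has binomial(k, m - 1) compositions into [m]
    positive parts, so a vertex counts once, an edge [k] times, and so on. *)
Lemma composition4_sumS k f (n := k%:R : R) : composition4_sum k.+1 f =
  f true true true false + f true true false true + f true false true true +
  f false true true true +
  n * (f true true false false + f true false true false + f true false false true +
       f false true true false + f false true false true + f false false true
         true) +
  n * (n - 1) / 2 * (f true false false false + f false true false false +
       f false false true false + f false false false true) +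
  n * (n - 1) * (n - 2) / 6 * f false false false false.
Proof.
pose S1 g m := \sum_(j < m.+1) g (j == 0 :> nat)%N (m - j == 0)%N : R.
pose S2 g m := \sum_(i < m.+1) S1 (g (i == 0 :> nat)%N) (m - i)%N : R.
have E1 g l : S1 g l.+1 = g true false + g false true + l%:R * g false false.
  rewrite /S1 (sum_ord_ends _ (fun b k => g b (k == 0)%N)) /=.
  rewrite (eq_bigr (fun=> g false false))// big_const_ord iter_addr addr0.
  by rewrite mulr_natl addrAC.
have E10 g : S1 g 0%N = g true true by rewrite /S1 big_ord_recl big_ord0 addr0.
have E2 g l : S2 g l.+1 =
  (g true true false + g true false true + g false true true)
    + l%:R * (g true false false + g false true false + g false false true)
    + l%:R * (l%:R - 1) / 2 * g false false false.
  rewrite /S2 (sum_ord_ends _ (fun b k => S1 (g b) k)) /= E10 E1.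
  rewrite (eq_bigr (fun i : 'I_l => (g false true false + g false false true) +
    i%:R * g false false false + i%:R * (i%:R - 1) / 2 * 0)) => [|i _].
    by rewrite sum_ord_binomial; field.
  by rewrite E1; ring.
have E20 g : S2 g 0%N = g true true true by rewrite /S2 big_ord_recl big_ord0
  addr0 E10.
rewrite /composition4_sum (sum_ord_ends _ (fun b k => S2 (f b) k)) /= E20 E2.
rewrite (eq_bigr (fun i : 'I_k =>
  (f false true true false + f false true false true + f false false true true) +
  i%:R * (f false true false false + f false false true false + f false false false true) +
  i%:R * (i%:R - 1) / 2 * f false false false
    false)) => [|i _]; last by rewrite E2.
by rewrite sum_ord_binomial /n; field.
Qed.

Lemma composition4_sum0 f : composition4_sum 0 f = f true true true true.
Proof. by rewrite /composition4_sum !big_ord_recl !big_ord0 !addr0. Qed.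

(** Independent ranges with a side condition, the shape of a sum over the finite index type of the
    lattice points. *)
Lemma composition4_sum_widen n m f : (m <= n)%N ->
  composition4_sum m f =
  \sum_(q < n.+1) \sum_(i < n.+1) \sum_(j < n.+1)
    if (q + i + j <= m)%N then
      f (q == 0 :> nat)%N (i == 0 :> nat)%N (j == 0 :> nat)%N
        (m - q - i - j == 0)%N
    else 0.
Proof.
move=> mn.
have widen k (g : nat -> R) : (k <= n)%N ->
    \sum_(i < k.+1) g i = \sum_(i < n.+1) if (i <= k)%N then g i else 0.
  by move=> kn; rewrite (big_ord_widen n.+1 g)// big_mkcond.
pose F3 q i j := f (q == 0)%N (i == 0)%N (j == 0)%N (m - q - i - j == 0)%N.
pose F2 q i := \sum_(j < (m - q - i).+1) F3 q i j.
pose F1 q := \sum_(i < (m - q).+1) F2 q i.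
apply: etrans (widen m F1 mn) _; apply: eq_bigr => q _.
case: leqP => qm; last first.
  rewrite big1// => i _; rewrite big1// => j _; case: ifP => // qijm.
  by have := leq_ltn_trans qijm qm; rewrite -addnA ltnNge leq_addr.
apply: etrans (widen (m - q)%N (F2 q) (leq_trans (leq_subr _ _) mn)) _.
apply: eq_bigr => i _; case: leqP => iq; last first.
  rewrite big1// => j _; case: ifP => // qijm.
  by move: iq; rewrite ltnNge leq_subRL// (leq_trans _ qijm)// leq_addr.
apply: etrans (widen (m - q - i)%N (F3 q i) _) _.
  by rewrite -subnDA (leq_trans (leq_subr _ _)).
have qim : (q + i <= m)%N by rewrite -leq_subRL.
apply: eq_bigr => j _; congr (if _ then _ else _).
by rewrite -subnDA leq_subRL.
Qed.

End compositions.

(** * Lattice points *)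

Section reeve_lattice_points.
Variable R : realType.
Variable h : nat.
Hypothesis h_gt0 : (0 < h)%N.
Variable n : nat.
Hypothesis n_gt0 : (0 < n)%N.

Local Notation H := (h%:R : R).

Let H_neq0 : H != 0. Proof. by rewrite pnatr_eq0 -lt0n. Qed.
Let H_gt0 : 0 < H. Proof. by rewrite ltr0n. Qed.

Local Notation index := ('I_h * ('I_n.+1 * ('I_n.+1 * 'I_n.+1)))%type.

(* At the lattice point with third coordinate [h * q + r], the barycentric
   coordinates times [n] have fractional parts [r / h] (twice) and, when [r > 0],
   [1 - r / h] (twice); [q], [i], [j] are the integer parts of three of them. *)
Definition reeve_point (t : index) : 'rV[R]_3 :=
  let: (r, (q, (i, j))) := t in
  point3 (q + j + (0 < r))%:R (q + i + (0 < r))%:R (h * q + r)%:R.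

(** The fourth integer part has to be nonnegative; for [r > 0] the four fractional parts add up to
    2, which is taken off [n]. *)
Definition reeve_index (t : index) : bool :=
  let: (r, (q, (i, j))) := t in (q + i + j + 2 * (0 < r) <= n)%N.

Lemma polyhedron_reeve_nat (x y z : nat) :
  polyhedron (reeve_facets h n%:R) (point3 x%:R y%:R z%:R : 'rV[R]_3) <->
  [/\ (h * (x + y) <= h * n + z)%N, (z <= h * y)%N & (z <= h * x)%N].
Proof.
have scale (a : R) : (0 <= a) = (0 <= H * a) by rewrite pmulr_rge0.
rewrite polyhedron_reeve !vec_simp (scale (n%:R + _))
  (scale (0 * _ + 1 * _ + _)).
rewrite (scale (1 * _ + 0 * _ + _)).
have -> : H * (n%:R + (-1 * x%:R + -1 * y%:R + H^-1 * z%:R)) =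
  (h * n + z)%:R - (h * (x + y))%:R by rewrite !(natrD, natrM); field.
have -> : H * (0 * x%:R + 1 * y%:R + - H^-1 * z%:R) = (h * y)%:R - z%:R.
  by rewrite natrM; field.
have -> : H * (1 * x%:R + 0 * y%:R + - H^-1 * z%:R) = (h * x)%:R - z%:R.
  by rewrite natrM; field.
by rewrite !subr_ge0 !ler_nat; split=> [[]//|[? ? ?]]; split.
Qed.

Lemma lattice_nat (v : 'rV[R]_3) : (forall j, v 0 j \is a Num.int) ->
  0 <= v 0 0 -> 0 <= v 0 1 -> 0 <= v 0 2 ->
  exists x y z : nat, v = point3 x%:R y%:R z%:R.
Proof.
move=> vint v0 v1 v2.
have nat_of j : 0 <= v 0 j -> exists k : nat, v 0 j = k%:R.
  by move=> vj; have := vint j; rewrite intrEge0// => /natrP[k]; exists k.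
have [x vx] := nat_of _ v0; have [y vy] := nat_of _ v1; have [z vz] :=
  nat_of _ v2.
by exists x, y, z; apply: row3P; rewrite !point3E.
Qed.

Lemma reeve_point_inj : {in reeve_index &, injective reeve_point}.
Proof.
move=> [r [q [i j]]] [r' [q' [i' j']]] _ _ /rowP E.
have := E 0; have := E 1; have := E 2; rewrite !point3E.
move=> /eqP; rewrite eqr_nat => /eqP Ez /eqP; rewrite eqr_nat => /eqP Ey.
move=> /eqP; rewrite eqr_nat => /eqP Ex {E}.
have Eq : q = q' :> nat.
  by have := congr1 (divn^~ h) Ez; rewrite /= ![(h * _)%N]mulnC !divnMDl//
    !divn_small ?addn0.
have Er : r = r' :> nat by lia.
have Ei : i = i' :> nat by move: Ey; rewrite Er; lia.
have Ej : j = j' :> nat by move: Ex; rewrite Er; lia.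
by rewrite (val_inj Eq) (val_inj Er) (val_inj Ei) (val_inj Ej).
Qed.

(** Euclidean division of the third coordinate by [h] yields [q] and [r]. By integrality the facet
    inequalities sharpen: [x] and [y] are at least the ceiling of [q + r / h], and [x + y - n] is at
    most its floor [q]. *)
Lemma reeve_lattice_points :
  polyhedron (reeve_facets h n%:R) `&` lattice R =
  [set` [seq reeve_point t | t <- enum {: index} & reeve_index t]].
Proof.
apply/seteqP; split => v; last first.
  move=> /= /mapP[[r [q [i j]]]]; rewrite mem_filter => /andP[+ _] ->.
  rewrite /reeve_index /= => qij; split.
    by apply/polyhedron_reeve_nat; have := ltn_ord r; case: (posnP r) => r0;
      split; nia.
  by elim/ord3P; rewrite point3E; exact: natr_int.
move=> [vP vL]; have [v2 v1 v0] : [/\ 0 <= v 0 2, 0 <= v 0 1 & 0 <= v 0 0].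
  have /polyhedron_reeve[_] := vP; rewrite !vec_simp => v1 v0 v2.
  have v20 : 0 <= v 0 2 by rewrite -(pmulr_rge0 _ (_ : 0 < H^-1)) ?invr_gt0//; lra.
  have : 0 <= H^-1 * v 0 2 by rewrite mulr_ge0// invr_ge0 ltW.
  by split=> //; lra.
have [x [y [z vE]]] := lattice_nat vL v0 v1 v2.
move: vP; rewrite vE => /polyhedron_reeve_nat[xyz zy zx] /=.
have zE := divn_eq z h; have r_lt := ltn_pmod z h_gt0.
move: (z %/ h)%N (z %% h)%N zE r_lt => q r zE r_lt.
have xyq : (x + y <= n + q)%N.
  by rewrite -ltnS -(ltn_pmul2l h_gt0); move: xyz; rewrite zE; nia.
have bound k : (z <= h * k)%N -> (q + (0 < r) <= k)%N.
  rewrite zE => zk; case: (posnP r) => r0; rewrite ?addn0 ?addn1.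
    by rewrite -(leq_pmul2l h_gt0); lia.
  by rewrite -(ltn_pmul2l h_gt0); lia.
have qx := bound _ zx; have qy := bound _ zy; clear bound.
have q_lt : (q < n.+1)%N by lia.
have i_lt : (y - (q + (0 < r)) < n.+1)%N by lia.
have j_lt : (x - (q + (0 < r)) < n.+1)%N by lia.
apply/mapP; exists (Ordinal r_lt, (Ordinal q_lt, (Ordinal i_lt, Ordinal j_lt))).
  by rewrite mem_filter mem_enum andbT /reeve_index /=; lia.
rewrite /reeve_point /=; congr (point3 _%:R _%:R _%:R); lia.
Qed.

(** For [r > 0] each facet form is a natural number plus a fraction strictly between 0 and 1, so no
    constraint is active. For [r = 0] the forms are [n - q - i - j], [i], [j], [q], in the order of
    the normals. *)
Lemma tangent_cone_reeve_point (t : index) : reeve_index t ->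
  tangent_cone (polyhedron (reeve_facets h n%:R)) (reeve_point t) =
  let: (r, (q, (i, j))) := t in
  cone (mask (if (0 < r)%N then nseq 4 false else
    [:: (n - q - i - j == 0)%N; (i == 0 :> nat)%N; (j == 0 :> nat)%N; (q == 0 :> nat)%N])
    (reeve_normals R h)).
Proof.
move: t => [r [q [i j]]] /= qij.
rewrite tangent_cone_polyhedron; last first.
  apply/polyhedron_reeve_nat; have := ltn_ord r; case: (posnP r) => r0; split; nia.
have rH : 0 <= H^-1 * r%:R < 1.
  by rewrite mulr_ge0 ?invr_ge0//= mulrC ltr_pdivrMr// mul1r ltr_nat ltn_ord.
have r_gt0 : (0 < r)%N -> 0 < H^-1 * r%:R by move=> r0;
  rewrite mulr_gt0 ?invr_gt0 ?ltr0n.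
set v := point3 _ _ _; pose e := (0 < r : nat)%N.
have E0 : n%:R + dot (point3 (-1) (-1) H^-1) v =
    (n - (q + i + j + 2 * e))%:R + H^-1 * r%:R.
  by rewrite !vec_simp natrB// !(natrD, natrM) -/e; field.
have E1 : 0 + dot (point3 0 1 (- H^-1)) v = (i + e)%:R - H^-1 * r%:R.
  by rewrite !vec_simp !(natrD, natrM) -/e; field.
have E2 : 0 + dot (point3 1 0 (- H^-1)) v = (j + e)%:R - H^-1 * r%:R.
  by rewrite !vec_simp !(natrD, natrM) -/e; field.
have E3 : 0 + dot (point3 0 0 H^-1) v = q%:R + H^-1 * r%:R.
  by rewrite !vec_simp !(natrD, natrM); field.
rewrite /reeve_facets /reeve_normals /= E0 E1 E2 E3 /e;
  case: (ltnP 0 r) => r0 /=.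
  have pD (k : nat) : 0 < k%:R + H^-1 * r%:R by exact: ltr_wpDl (ler0n _ _)
    (r_gt0 r0).
  have pB (k : nat) : 0 < (k + 1)%:R - H^-1 * r%:R.
    by rewrite subr_gt0 addn1 -natr1 ltr_wpDl// (andP rH).2.
  by rewrite !(gt_eqF (pD _)) !(gt_eqF (pB _)).
have -> : r%:R = 0 :> R by case: (nat_of_ord r) r0.
rewrite mulr0 !subr0 !addr0 muln0 !addn0 !pnatr_eq0.
rewrite !subnDA.
move: (n - q - i - j == 0)%N (i == 0 :> nat)%N (j == 0 :> nat)%N
  (q == 0 :> nat)%N.
by move=> [] [] [] [].
Qed.

Variables (gamma : nat -> probability (borel 'M[R]_3) R)
          (sigma : probability (borel 'rV[R]_3) R).

Let cone_angle b0 b1 b2 b3 :=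
  grassmann_angle gamma sigma 1
    (cone (mask [:: b0; b1; b2; b3] (reeve_normals R h))).

Lemma grassmann_sum_reeve (hgamma : haar_grassmannian 2 (gamma 2%N)) :
  grassmann_sum gamma sigma 1 (dilate n (reeve R h)) =
  composition4_sum n (fun bq bi bj b0 => cone_angle b0 bi bj bq) +
  (h.-1)%:R * (if (2 <= n)%N then composition4_sum (n - 2) (fun _ _ _ _ => 1) else 0).
Proof.
rewrite /grassmann_sum dilate_reeve// reeve_lattice_points -fsbig_seq;
  last first.
  rewrite map_inj_in_uniq; first exact/filter_uniq/enum_uniq.
  move=> s t; rewrite !mem_filter => /andP[s_ok _] /andP[t_ok _].
  exact: reeve_point_inj.
rewrite big_map big_filter big_enum_cond /= big_mkcond /=.
pose F (r q i j : nat) : R := if (q + i + j + 2 * (0 < r) <= n)%N then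
  (if (0 < r)%N then 1 else
     cone_angle (n - q - i - j == 0)%N (i == 0)%N (j == 0)%N (q == 0)%N) else 0.
rewrite (eq_bigr (fun t : index => F t.1 t.2.1 t.2.2.1 t.2.2.2)); last first.
  move=> t _; case: ifP => [t_ok|]; last first.
    by case: t => [r [q [i j]]]; rewrite /F /= => ->.
  rewrite tangent_cone_reeve_point//; case: t t_ok => [r [q [i j]]] /=;
    rewrite /F => -> /=.
  case: ifP => // _; rewrite (_ : cone _ = setT) ?grassmann_angle_full//.
  by apply/seteqP; split => // x _ N; rewrite inE.
rewrite -(pair_bigA _ (fun (r : 'I_h) (s : 'I_n.+1 * ('I_n.+1 * 'I_n.+1)) =>
  F r s.1 s.2.1 s.2.2)) /=.
rewrite (eq_bigr (fun r : 'I_h => \sum_(q < n.+1) \sum_(i < n.+1) \sum_(j < n.+1) F r q i j));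
  last first.
  move=> r _; rewrite -(pair_bigA _ (fun (q : 'I_n.+1) (s : 'I_n.+1 * 'I_n.+1) =>
    F r q s.1 s.2)) /=.
  apply: eq_bigr => q _.
  by rewrite -(pair_bigA _ (fun (i : 'I_n.+1) (j : 'I_n.+1) => F r q i j)).
rewrite (bigD1 (Ordinal h_gt0))//=; congr (_ + _).
  rewrite (composition4_sum_widen _ (leqnn n)); apply: eq_bigr => q _.
  by apply: eq_bigr => i _; apply: eq_bigr => j _; rewrite /F /= muln0 addn0.
rewrite (eq_bigr (fun=> if (2 <= n)%N then composition4_sum (n - 2) (fun _ _ _ _ => 1) else 0)).
  by rewrite sumr_const cardC1 card_ord mulr_natl.
(* For [n = 1] these layers are empty, whereas the truncated [n - 2] would count one point in
   each. *)
move=> r; rewrite -val_eqE /= -lt0n => r0; case: (leqP 2 n) => n2; last first.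
  rewrite big1// => q _; rewrite big1// => i _; rewrite big1// => j _.
  by rewrite /F r0 muln1 ifN// -ltnNge (leq_trans n2)// leq_addl.
rewrite (composition4_sum_widen _ (leq_subr 2 n)); apply: eq_bigr => q _.
apply: eq_bigr => i _; apply: eq_bigr => j _; rewrite /F r0 muln1 /=.
by rewrite addnC -leq_subRL.
Qed.

End reeve_lattice_points.

Section reeve_solid_angles.
Variable R : realType.
Variable h : nat.
Hypothesis h_gt0 : (0 < h)%N.
Variable sigma : probability (borel 'rV[R]_3) R.

Let solid b0 b1 b2 b3 :=
  fine (sigma (cone (mask [:: b0; b1; b2; b3] (reeve_normals R h)))).

Lemma solid_angle_sum_reeve : solid_angle_sum sigma (reeve R h) =
  solid false true true true + solid true false true true +
  solid true true false true + solid true true true false.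
Proof.
have H_neq0 : h%:R != 0 :> R by rewrite pnatr_eq0 -lt0n.
rewrite /solid_angle_sum vertices_reeve// -fsbig_seq; last first.
  have /allP/= := @reeve_edges_neq0 R h; rewrite !subr_eq0
    ![_ == point3 0 0 0]eq_sym.
  rewrite ![_ == point3 0 1 0]eq_sym ![_ == point3 1 0 0]eq_sym.
  rewrite [point3 0 1 0 == point3 0 0 0]eq_sym
    [point3 1 0 0 == point3 0 0 0]eq_sym.
  rewrite [point3 1 0 0 == point3 0 1 0]eq_sym.
  by rewrite /= !inE !negb_or => /and5P[-> -> -> -> /and3P[-> ->]].
(* The vertices are the lattice points of the first dilate with [r = 0], one of the four parts being
   1. *)
have T (q i j : 'I_2) : (q + i + j <= 1)%N ->
    tangent_cone (reeve R h) (point3 (q + j)%:R (q + i)%:R (h * q)%:R) =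
    cone (mask [:: (1 - q - i - j == 0)%N; (i == 0 :> nat)%N; (j == 0 :> nat)%N;
                   (q == 0 :> nat)%N] (reeve_normals R h)).
  move=> qij; have := @tangent_cone_reeve_point R h h_gt0 1 isT
    (Ordinal h_gt0, (q, (i, j))); rewrite /reeve_index /reeve_point /= muln0
      !addn0.
  by move=> /(_ qij) <-; rewrite reeveE.
rewrite !big_cons big_nil /= addr0 !addrA /solid_angle /solid.
have := T 0 0 0 isT; rewrite /= muln0 => ->.
have := T 0 1 0 isT; rewrite /= muln0 => ->.
have := T 0 0 1 isT; rewrite /= muln0 => ->.
by have := T 1 0 0 isT; rewrite /= muln1 => ->.
Qed.

End reeve_solid_angles.

(** * Adding up the angles face by face *)

Theorem theorem1p5 (R : realType)
    (gamma : nat -> probability (borel 'M[R]_3) R)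
    (sigma : probability (borel 'rV[R]_3) R)
    (hgamma : forall m : nat, (m <= 3)%N -> haar_grassmannian m (gamma m))
    (hsigma : uniform_sphere sigma)
    (h : nat) (hpos : (0 < h)%N) :
  grassmann_poly gamma sigma 1 (reeve R h) =
    (h%:R / 6) *: 'X^3 + 'X^2
    + (solid_angle_sum sigma (reeve R h) - h%:R / 6) *: 'X.
Proof.
have hgamma2 := hgamma 2%N isT.
apply: grassmann_polyE => n n_gt0.
rewrite grassmann_sum_reeve// solid_angle_sum_reeve//.
rewrite !(hornerD, hornerZ, hornerXn, hornerX).
have edges := edge_angles_sum hgamma2 hsigma (@reeve_sum_normals R h hpos)
  (@reeve_decomposition R h hpos) (@reeve_wedges_neq0 R h hpos).
have verts := vertex_angles_sum hgamma2 hsigma (@reeve_sum_normals R h hpos)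
  (@reeve_decomposition R h hpos) (@reeve_edges_neq0 R h)
    (@reeve_wedges_neq0 R h hpos).
(* The count binomial(n + 1, 3) also vanishes at [n = 1], which makes one polynomial valid for all
   positive [n]. *)
have interior : (if (2 <= n)%N then composition4_sum (n - 2) (fun _ _ _ _ => 1 : R) else 0) =
    (n%:R + 1) * n%:R * (n%:R - 1) / 6.
  case: n n_gt0 => [//|[_|[_|n _]]]; first by rewrite /= !mulr1n; field.
    by rewrite composition4_sum0; field.
  by rewrite subSS subn1 /= composition4_sumS -!natr1; field.
rewrite interior; case: n n_gt0 {interior} => // k _.
rewrite composition4_sumS /= -[k.+1%:R]natr1.
rewrite !(grassmann_angle_halfspace sigma hgamma2) (_ : cone [::] = setT);
  last first.
  by apply/seteqP; split => // x _ N; rewrite inE.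
rewrite (grassmann_angle_full sigma hgamma2).
have -> : h.-1%:R = h%:R - 1 :> R by rewrite -[in RHS](prednK hpos) -natr1 addrK.
move: edges verts; set n0 := point3 (-1) (-1) _; set n1 := point3 0 1 _.
set n2 := point3 1 0 _; set n3 := point3 0 0 _; pose a l :=
  grassmann_angle gamma sigma 1 (cone l).
rewrite -![grassmann_angle _ _ _ _]/(a _);
  move: (fine _) (fine _) (fine _) (fine _).
move: (a [:: n1; n2; n3]) (a [:: n0; n2; n3]) (a [:: n0; n1; n3])
  (a [:: n0; n1; n2]).
move: (a [:: n0; n1]) (a [:: n0; n2]) (a [:: n0; n3]) (a [:: n1; n2])
  (a [:: n1; n3]).
move=> e01 e02 e03 e12 e13 v0 v1 v2 v3 s0 s1 s2 s3 edges verts.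
(* Only the sums of edge and vertex angles enter, so eliminating one angle of each kind makes all
   the others cancel. *)
have -> : a [:: n2; n3] = s3 + s2 + s1 + s0 + 4 - e01 - e02 - e03 - e12 - e13.
  by rewrite -edges; ring.
have -> : v3 = s3 + s2 + s1 + s0 + 1 - v0 - v1 - v2 by rewrite -verts; ring.
by field.
Qed.
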